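(* Let $k\ge0$ be an integer. In $\bigwedge^k\Omega^1(G)\otimes_{\mathbb R}\bigwedge^k\Omega^1(G)$, the following equality holds: $$\sum_{K\in\mathcal C_k(G)}\underline x^K\big((J^1_{\underline x})^{\wedge k}\det\mathscr Z^K\big)^{\otimes2}=T(\underline x)\sum_{S\subseteq E^+,\,|S|=k}(\Pi^{\ker d^*})^{\wedge k}\Big(\frac{e^\star_S}{\sqrt{\underline x^S}}\Big)\otimes\frac{e^\star_S}{\sqrt{\underline x^S}},$$ where $T(\underline x)=\sum_{T\in\mathcal T(G)}\underline x^T$.
   Context: Let $\mathbb K=\mathbb R$ or $\mathbb C$. $G=(V,E)$ is a finite connected graph: $V$ is a finite set of vertices and $E$ a finite set of oriented edges, with source and target maps $s,t:E\to V$ and a fixed-point-free involution $e\mapsto e^{-1}$ of $E$ exchanging source and target. $E^+\subset E$ is a fixed subset containing exactly one element of each pair $\{e,e^{-1}\}$, with a fixed total order. Positive weights $\underline x=(x_e)_{e\in E}$ with $x_{e^{-1}}=x_e$ are given, and $\underline x^A=\prod_{e\in (A\cup A^{-1})\cap E^+}x_e$ for $A\subseteq E$. A subgraph is a subset $S\subseteq E$ stable under $e\mapsto e^{-1}$, seen as the graph $(V,S)$. $\mathcal T(G)$ is the set of spanning trees; $\mathcal C_k(G)$ is the set of connected (spanning) subgraphs with first Betti number $k$. $C_1(G)$ is the free abelian group on $E$ modulo $e+e^{-1}=0$; $\partial e=t(e)-s(e)$ in the free abelian group on $V$; for a subgraph $K$, $Z_1(K)$ is the kernel of $\partial$ on the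 subgroup of $C_1(G)$ generated by the edges of $K$. For $K\in\mathcal C_k(G)$, $\mathscr Z^K=(z_1,\dots,z_k)$ is any $\mathbb Z$-basis of $Z_1(K)$ and $\det\mathscr Z^K=z_1\wedge\dots\wedge z_k$ (well defined up to sign, so that its tensor square is well defined), seen in $\bigwedge^k\Omega_1(G)$. $\Omega_1(G)=C_1(G)\otimes\mathbb K$, $\Omega^1(G)=\mathrm{Hom}(C_1(G),\mathbb K)$ with basis $(e^\star)_{e\in E^+}$ dual to $E^+$ and inner product $\langle\alpha,\beta\rangle=\sum_{e\in E^+}x_e\overline{\alpha(e)}\beta(e)$; $\Omega^0(G)=\mathbb K^V$ with its standard inner product; $df(e)=f(t(e))-f(s(e))$; $d^*$ is the adjoint of $d$; $\Pi^{\ker d^*}$ is the orthogonal projection on $\ker d^*$. $J^1_{\underline x}:\Omega_1(G)\to\Omega^1(G)$ is the antilinear isomorphism with $J^1_{\underline x}(e)=x_e^{-1}e^\star$. $a^{\wedge k}$ is the map induced by $a$ on $k$-th exterior powers (over $\mathbb K$). For $S=\{e_1<\dots<e_k\}\subseteq E^+$, $e^\star_S=e^\star_1\wedge\dots\wedge e^\star_k$. The outer tensor product is over $\mathbb R$ even if $\mathbb K=\mathbb C$, and $u^{\otimes2}=u\otimes u$. *)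

(* Defs.v *)
From HB Require Import structures.
From mathcomp Require Import all_boot all_order all_algebra.
From mathcomp Require Import ring_quotient freeg complex.
From mathcomp Require Import boolp classical_sets functions reals.

Set Implicit Arguments.
Unset Strict Implicit.
Unset Printing Implicit Defensive.

Import Order.TTheory GRing.Theory Num.Theory.
Local Open Scope ring_scope.
Local Open Scope quotient_scope.

(* Modules presented by generators and relations: [pres rel] is the quotient
   of the free [K]-module on [X] by the submodule generated by the elements
   satisfying [rel]. *)
Section Presentation.
Variables (K : nzRingType) (X : choiceType) (rel : {freeg X / K} -> Prop).

Definition relspan : {pred {freeg X / K}} := fun f =>
  `[< exists2 s : seq (K * {freeg X / K}),
        (forall cr, cr \in s -> rel cr.2) & f = \sum_(cr <- s) cr.1 *: cr.2 >].

Lemma relspanP f : reflect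
  (exists2 s : seq (K * {freeg X / K}),
     (forall cr, cr \in s -> rel cr.2) & f = \sum_(cr <- s) cr.1 *: cr.2)
  (f \in relspan).
Proof. exact: asboolP. Qed.

Lemma relspanZ a f : f \in relspan -> a *: f \in relspan.
Proof.
case/relspanP=> s Hs ->; apply/relspanP.
exists [seq (a * cr.1, cr.2) | cr <- s].
  by move=> _ /mapP[cr /Hs rcr ->].
by rewrite big_map scaler_sumr; apply: eq_bigr => i _; rewrite scalerA.
Qed.

Lemma relspan_zmod_closed : zmod_closed relspan.
Proof.
split; first by apply/relspanP; exists [::]; rewrite ?big_nil.
move=> f g /relspanP[s Hs ->] /(relspanZ (-1)) /relspanP[t Ht].
rewrite scaleN1r => ->; apply/relspanP; exists (s ++ t); last by rewrite big_cat.
by move=> cr; rewrite mem_cat => /orP[/Hs|/Ht].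
Qed.
HB.instance Definition _ :=
  GRing.isZmodClosed.Build {freeg X / K} relspan relspan_zmod_closed.

Lemma relspan_rel r : rel r -> r \in relspan.
Proof.
move=> Hr; apply/relspanP; exists [:: (1, r)]; last by rewrite big_seq1 scale1r.
by move=> cr; rewrite inE => /eqP ->.
Qed.

Definition pres : Type := Quotient.quot relspan.
HB.instance Definition _ := GRing.Zmodule.on pres.

Definition pres_pi (f : {freeg X / K}) : pres := \pi_(Quotient.quot relspan) f.
Definition pres_repr (p : pres) : {freeg X / K} :=
  repr (p : Quotient.quot relspan).

Lemma pres_reprK : cancel pres_repr pres_pi.
Proof. by move=> p; exact: reprK. Qed.

Lemma pres_pi_eq f g : (pres_pi f == pres_pi g) = (f - g \in relspan).
Proof. by rewrite Quotient.idealrBE. Qed.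

Lemma pres_piD f g : pres_pi (f + g) = pres_pi f + pres_pi g.
Proof. exact: (raddfD (\pi_(Quotient.quot relspan))). Qed.

Definition pres_scale a p : pres := pres_pi (a *: pres_repr p).

Lemma pres_scale_pi a f : pres_scale a (pres_pi f) = pres_pi (a *: f).
Proof.
apply/eqP; rewrite pres_pi_eq -scalerBr; apply: relspanZ.
by rewrite -pres_pi_eq pres_reprK.
Qed.

Fact pres_scaleA a b p : pres_scale a (pres_scale b p) = pres_scale (a * b) p.
Proof. by rewrite -[p]pres_reprK !pres_scale_pi scalerA. Qed.
Fact pres_scale1 : left_id 1 pres_scale.
Proof. by move=> p; rewrite -[p]pres_reprK pres_scale_pi scale1r. Qed.
Fact pres_scaleDr : right_distributive pres_scale +%R.
Proof.
move=> a p q; rewrite -[p]pres_reprK -[q]pres_reprK -pres_piD.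
by rewrite !pres_scale_pi scalerDr pres_piD.
Qed.
Fact pres_scaleDl p : {morph pres_scale^~ p : a b / a + b}.
Proof.
by move=> a b; rewrite -[p]pres_reprK !pres_scale_pi scalerDl pres_piD.
Qed.
HB.instance Definition _ := GRing.Zmodule_isLmodule.Build K pres
  pres_scaleA pres_scale1 pres_scaleDr pres_scaleDl.

Definition pgen (x : X) : pres := pres_pi << x >>.

Lemma pres_piZ a f : pres_pi (a *: f) = a *: pres_pi f.
Proof. by rewrite -pres_scale_pi. Qed.

Lemma pres_piE f : pres_pi f = \sum_(x <- dom f) coeff x f *: pgen x.
Proof.
have pi_sum (s : seq X) F :
    pres_pi (\sum_(x <- s) F x) = \sum_(x <- s) pres_pi (F x).
  exact: (raddf_sum (\pi_(Quotient.quot relspan))).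
rewrite -{1}[f]freeg_sumE pi_sum; apply: eq_bigr => x _.
rewrite -pres_piZ; congr pres_pi; apply/eqP/freeg_eqP => y.
by rewrite coeffZ !coeffU mul1r.
Qed.

End Presentation.

(* Maps out of a presented module: the [sigma]-semilinear extension of a map
   [g] defined on generators.  It is meaningful when the extension of [g] to
   the free module kills the relations; see [plift_gen] and [plift_semilin]. *)
Section Lift.
Variables (K L : nzRingType) (sigma : {rmorphism K -> L}).
Variables (X : choiceType) (M : lmodType L) (g : X -> M).

Definition freelift (f : {freeg X / K}) : M :=
  \sum_(x <- dom f) sigma (coeff x f) *: g x.

Lemma freelift_sup (s : seq X) f : uniq s -> {subset dom f <= s} ->
  freelift f = \sum_(x <- s) sigma (coeff x f) *: g x.
Proof.
move=> us sub; rewrite /freelift [RHS](bigID (mem (dom f))) /=.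
rewrite [X in _ + X]big1 ?addr0; last first.
  by move=> x /coeff_outdom ->; rewrite rmorph0 scale0r.
rewrite -[RHS]big_filter; apply: perm_big; apply: uniq_perm.
- exact: uniq_dom.
- exact: filter_uniq.
by move=> x; rewrite mem_filter; case: (boolP (x \in dom f)) => //= /sub ->.
Qed.

Lemma freeliftP a f h :
  freelift (a *: f + h) = sigma a *: freelift f + freelift h.
Proof.
pose s := undup (dom f ++ dom h ++ dom (a *: f + h)).
have us : uniq s by exact: undup_uniq.
rewrite !(freelift_sup us) => [|x xd|x xd|x xd];
  try by rewrite mem_undup !mem_cat xd ?orbT.
rewrite scaler_sumr -big_split; apply: eq_bigr => x _ /=.
by rewrite coeffD coeffZ rmorphD rmorphM scalerDl scalerA.
Qed.

Lemma freeliftZ a f : freelift (a *: f) = sigma a *: freelift f.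
Proof.
have f0 : freelift 0 = 0 by rewrite /freelift dom0 big_nil.
by rewrite -[a *: f]addr0 freeliftP f0 addr0.
Qed.

Lemma freeliftD f h : freelift (f + h) = freelift f + freelift h.
Proof. by rewrite -[f]scale1r freeliftP rmorph1 !scale1r. Qed.

Lemma freeliftB f h : freelift (f - h) = freelift f - freelift h.
Proof.
by rewrite [f - h]addrC -[- h]scaleN1r freeliftP rmorphN1 scaleN1r addrC.
Qed.

Lemma freeliftU x : freelift << x >> = g x.
Proof. by rewrite /freelift domU1 big_seq1 coeffU eqxx mulr1 rmorph1 scale1r. Qed.

Variable rel : {freeg X / K} -> Prop.

Definition plift (p : pres rel) : M := freelift (pres_repr p).

Hypothesis rel0 : forall r, rel r -> freelift r = 0.

Lemma plift_pi f : plift (pres_pi rel f) = freelift f.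
Proof.
apply/eqP; rewrite -subr_eq0 -freeliftB.
have: pres_repr (pres_pi rel f) - f \in relspan rel.
  by rewrite -pres_pi_eq pres_reprK.
case/relspanP=> s Hs ->; rewrite (big_morph _ freeliftD (id1 := 0)); last first.
  by rewrite /freelift dom0 big_nil.
rewrite big_seq big1 // => cr /Hs /rel0 h.
by rewrite freeliftZ h scaler0.
Qed.

Lemma plift_gen x : plift (pgen rel x) = g x.
Proof. by rewrite plift_pi freeliftU. Qed.

Lemma plift_semilin a p q : plift (a *: p + q) = sigma a *: plift p + plift q.
Proof.
rewrite -[p]pres_reprK -[q]pres_reprK -pres_piZ -pres_piD !plift_pi.
by rewrite freeliftP.
Qed.

Lemma pliftD p q : plift (p + q) = plift p + plift q.
Proof. by rewrite -[p]scale1r plift_semilin rmorph1 !scale1r. Qed.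

End Lift.

Arguments plift {K L} sigma {X M} g {rel} p.

Section Constructions.

(* A (x)_Z K, generated by the a (x) 1. *)
Definition extscal_rel (K : nzRingType) (A : zmodType) (r : {freeg A / K}) :=
  exists a b : A, r = << a + b >> - << a >> - << b >>.
Definition extscal (K : nzRingType) (A : zmodType) := pres (@extscal_rel K A).
Definition tens1 (K : nzRingType) (A : zmodType) (a : A) : extscal K A :=
  pgen _ a.

Definition upd (k : nat) (V : choiceType) (v : {ffun 'I_k -> V}) i u :=
  [ffun j => if j == i then u else v j].

(* The [k]-th exterior power, generated by the v_1 /\ ... /\ v_k. *)
Definition ext_rel (K : nzRingType) (V : lmodType K) (k : nat)
    (r : {freeg {ffun 'I_k -> V} / K}) : Prop :=
  (exists (v : {ffun 'I_k -> V}) i a u w, r = << upd v i (a *: u + w) >>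
                         - a *: << upd v i u >> - << upd v i w >>)
  \/ (exists (v : {ffun 'I_k -> V}) i j, [/\ i != j, v i = v j & r = << v >>]).
Definition ext (K : nzRingType) (V : lmodType K) (k : nat) :=
  pres (@ext_rel K V k).
Definition wedge (K : nzRingType) (V : lmodType K) (k : nat)
  (v : {ffun 'I_k -> V}) : ext V k := pgen _ v.

(* The map v_1 /\ ... /\ v_k |-> a v_1 /\ ... /\ a v_k induced by a
   [sigma]-semilinear map [a]; see [extmap_wedge]. *)
Definition extmap (K L : nzRingType) (sigma : {rmorphism K -> L})
    (V : lmodType K) (W : lmodType L) (a : V -> W) (k : nat) : ext V k -> ext W k :=
  plift sigma (fun v : {ffun 'I_k -> V} => wedge [ffun i => a (v i)]).

(* A (x)_R B for modules A, B over an R-algebra [iota : R -> K]. *)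
Definition tensor_rel (R K : nzRingType) (iota : {rmorphism R -> K})
    (A B : lmodType K) (r : {freeg (A * B)%type / R}) : Prop :=
  (exists (c : R) a a' b,
     r = << (iota c *: a + a', b) >> - c *: << (a, b) >> - << (a', b) >>)
  \/ (exists (c : R) a b b',
     r = << (a, iota c *: b + b') >> - c *: << (a, b) >> - << (a, b') >>).
Definition tensor (R K : nzRingType) (iota : {rmorphism R -> K})
  (A B : lmodType K) := pres (@tensor_rel R K iota A B).
Definition tens (R K : nzRingType) (iota : {rmorphism R -> K})
  (A B : lmodType K) (a : A) (b : B) : tensor iota A B := pgen _ (a, b).

End Constructions.

Lemma ext_pi_rel0 (K : nzRingType) (V : lmodType K) (k : nat) (r : {freeg {ffun 'I_k -> V} / K}) :
  ext_rel r -> pres_pi (@ext_rel K V k) r = 0.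
Proof.
move=> /relspan_rel; rewrite -[X in X \in _]subr0 -pres_pi_eq => /eqP ->.
exact: (raddf0 (\pi_(Quotient.quot (relspan (@ext_rel K V k))))).
Qed.

Section ExtmapFacts.
Variables (K L : nzRingType) (sigma : {rmorphism K -> L}).
Variables (V : lmodType K) (W : lmodType L) (a : V -> W) (k : nat).
Hypothesis a_semilin : forall c u w, a (c *: u + w) = sigma c *: a u + a w.

Lemma extmap_rel0 r : @ext_rel K V k r ->
  freelift sigma (fun v : {ffun 'I_k -> V} => wedge [ffun i => a (v i)]) r = 0.
Proof.
case=> [[v [i [c [u [w ->]]]]]|[v [i [j [ij vij ->]]]]].
  rewrite !freeliftB freeliftZ !freeliftU.
  pose v' := [ffun i => a (v i)].
  have E z : [ffun i0 => a (upd v i z i0)] = upd v' i (a z).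
    by apply/ffunP => j; rewrite !ffunE; case: ifP.
  rewrite !E a_semilin /wedge /pgen -pres_piZ.
  have piB f g : pres_pi (@ext_rel L W k) (f - g) = pres_pi _ f - pres_pi _ g.
    exact: (raddfB (\pi_(Quotient.quot (relspan (@ext_rel L W k))))).
  rewrite -!piB; apply: ext_pi_rel0; left.
  by exists v', i, (sigma c), (a u), (a w).
rewrite freeliftU; apply: ext_pi_rel0; right.
by exists [ffun i => a (v i)], i, j; rewrite !ffunE vij.
Qed.

Lemma extmap_wedge v :
  extmap sigma a (wedge v) = wedge [ffun i : 'I_k => a (v i)].
Proof. exact: plift_gen extmap_rel0 _. Qed.

Lemma extmap_semilin c (p q : ext V k) :
  extmap sigma a (c *: p + q) = sigma c *: extmap sigma a p + extmap sigma a q.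
Proof. exact: plift_semilin extmap_rel0 _ _ _. Qed.

End ExtmapFacts.

(* Hom(A, K) as a K-module. *)
Section Hom.
Variables (A : zmodType) (K : comNzRingType).

Definition is_hom : {pred A -> K^o} := fun f =>
  `[< forall a b, f (a + b) = f a + f b >].

Fact is_hom_submod_closed : submod_closed is_hom.
Proof.
split=> [|c f g /asboolP Hf /asboolP Hg]; apply/asboolP => a b.
  by rewrite /= addr0.
rewrite !fctE Hf Hg scalerDr addrACA //.
Qed.
HB.instance Definition _ :=
  GRing.isSubmodClosed.Build K (A -> K^o) is_hom is_hom_submod_closed.

Record hom := Hom { hom_fun :> A -> K^o; _ : hom_fun \in is_hom }.
HB.instance Definition _ := [isSub for hom_fun].
HB.instance Definition _ := [Choice of hom by <:].
HB.instance Definition _ := [SubChoice_isSubLmodule of hom by <:].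

End Hom.

(* The field R or C. *)
Variant scalars := Reals | Complexes.

Definition fieldK (R : realType) (F : scalars) : fieldType :=
  match F with Reals => R | Complexes => R[i] end.

Definition ofR (R : realType) (F : scalars) : {rmorphism R -> fieldK R F} :=
  match F return {rmorphism R -> fieldK R F} with
  | Reals => idfun
  | Complexes => real_complex R
  end.

Definition conjK (R : realType) (F : scalars) :
    {rmorphism fieldK R F -> fieldK R F} :=
  match F return {rmorphism fieldK R F -> fieldK R F} with
  | Reals => idfun
  | Complexes => @conjc R
  end.

(* Finite graphs in the sense of Serre: loops and multiple edges are allowed,
   and [edge] is the set of oriented edges. *)
Record graph := Graph {
  vertex : finType;
  edge : finType;
  src : edge -> vertex;
  tgt : edge -> vertex;
  einv : edge -> edge;
  einvK : involutive einv;
  einv_neq : forall e, einv e != e;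
  src_einv : forall e, src (einv e) = tgt e;
  tgt_einv : forall e, tgt (einv e) = src e
}.
Arguments src {g}.
Arguments tgt {g}.
Arguments einv {g}.

Section Subgraphs.
Variable G : graph.
Implicit Types S : {set edge G}.

Definition is_subgraph S := [forall e in S, einv e \in S].

Definition adj S (u v : vertex G) :=
  [exists e in S, (src e == u) && (tgt e == v)].

(* The graph (V, S) is nonempty and connected. *)
Definition connected S :=
  (0 < #|vertex G|)%N && [forall u, forall v, connect (adj S) u v].

(* Non-backtracking closed edge paths with distinct vertices; a loop is a
   circuit of length 1. *)
Definition circuit S (p : seq (edge G)) :=
  [&& p != [::], all (mem S) p, uniq (map src p)
    & cycle (fun e f => (tgt e == src f) && (f != einv e)) p].

Definition acyclic S := forall p, ~~ circuit S p.

Definition spanning_trees : {set {set edge G}} :=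
  [set S | [&& is_subgraph S, connected S & `[< acyclic S >]]].

Definition is_orientation (Ep : {set edge G}) :=
  forall e, (e \in Ep) (+) (einv e \in Ep).

Definition is_total_order_on (Ep : {set edge G}) (le : rel (edge G)) :=
  [/\ {in Ep, reflexive le}, {in Ep &, antisymmetric le},
      {in Ep & &, transitive le} & {in Ep &, total le}].

Definition C0 : lmodType int := {freeg (vertex G) / int}.

Definition C1_rel (r : {freeg (edge G) / int}) :=
  exists e, r = << e >> + << einv e >>.
Definition C1 : lmodType int := pres C1_rel.

Definition ech (e : edge G) : C1 := pgen C1_rel e.

Definition bd : C1 -> C0 :=
  plift idfun (fun e => << tgt e >> - << src e >> : C0).

Definition Z1 S (c : C1) : Prop :=
  (exists a : edge G -> int, c = \sum_(e in S) a e *: ech e) /\ bd c = 0.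

(* [z] is a Z-basis of the subgroup [Z] *)
Definition is_Zbasis (Z : C1 -> Prop) k (z : 'I_k -> C1) :=
  (forall i, Z (z i)) /\
  (forall c, Z c -> exists! a : {ffun 'I_k -> int}, c = \sum_i a i *: z i).

(* The first Betti number of (V, S) is the rank of H_1 = Z_1(S). *)
Definition first_betti S k := exists z : 'I_k -> C1, is_Zbasis (Z1 S) z.

Definition conn_subgraphs k : {set {set edge G}} :=
  [set S | [&& is_subgraph S, connected S & `[< first_betti S k >]]].

Lemma C1_rel0 (L : nzRingType) (M : lmodType L) (g : edge G -> M) r :
  (forall e, g (einv e) = - g e) -> C1_rel r -> freelift intr g r = 0.
Proof.
by move=> grev [e ->]; rewrite freeliftD !freeliftU grev addrN.
Qed.

Lemma bd_ech e : bd (ech e) = << tgt e >> - << src e >>.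
Proof.
rewrite /bd /ech plift_gen // => r [f ->].
by rewrite freeliftD !freeliftU src_einv tgt_einv addrC subrKA addrN.
Qed.

End Subgraphs.

Arguments bd {G}.

Section Forms.
Variables (G : graph) (R : realType) (F : scalars).
Local Notation K := (fieldK R F).
Local Notation iota := (ofR R F).
Local Notation conj := (conjK R F).

Definition weight (Ep : {set edge G}) (x : edge G -> R) (A : {set edge G}) : R :=
  \prod_(e in (A :|: einv @: A) :&: Ep) x e.

Definition Omega_1 : lmodType K := extscal K (C1 G).
Definition Omega0 : lmodType K := {ffun vertex G -> K^o}.
Definition Omega1 : lmodType K := hom (C1 G) K.

Lemma cochain_hom (a : edge G -> K^o) : (forall e, a (einv e) = - a e) ->
  (plift intr a : C1 G -> K^o) \in @is_hom (C1 G) K.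
Proof. by move=> ha; apply/asboolP => b c; apply: pliftD => r; exact: C1_rel0. Qed.

(* The homomorphism C_1(G) -> K with value [a e] on the edge [e]. *)
Definition cochain (a : edge G -> K^o) (ha : forall e, a (einv e) = - a e) :
  Omega1 := Hom (cochain_hom ha).

Lemma cochain_ech a ha e : @cochain a ha (ech e) = a e.
Proof. by rewrite /= /ech plift_gen // => r; exact: C1_rel0. Qed.

Lemma estar_rev (e f : edge G) :
  (einv f == e)%:R - (einv f == einv e)%:R = - ((f == e)%:R - (f == einv e)%:R) :> K^o.
Proof.
by rewrite (can2_eq (@einvK G) (@einvK G)) (inj_eq (can_inj (@einvK G))) opprB.
Qed.

(* Defined for every edge, so that [estar (einv e) = - estar e]. *)
Definition estar (e : edge G) : Omega1 := cochain (estar_rev e).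

Lemma dOmega_rev (f : Omega0) (e : edge G) :
  f (tgt (einv e)) - f (src (einv e)) = - (f (tgt e) - f (src e)).
Proof. by rewrite src_einv tgt_einv opprB. Qed.

Definition dOmega (f : Omega0) : Omega1 := cochain (dOmega_rev f).

Definition inner0 (f g : Omega0) : K := \sum_v conj (f v) * g v.

Definition inner1 (Ep : {set edge G}) (x : edge G -> R) (a b : Omega1) : K :=
  \sum_(e in Ep) iota (x e) * conj (a (ech e)) * b (ech e).

Definition dstar (Ep : {set edge G}) (x : edge G -> R) (a : Omega1) : Omega0 :=
  (* the default 0 is never used: the adjoint exists in finite dimension *)
  xget 0 [set f | forall g, inner1 Ep x (dOmega g) a = inner0 g f]%classic.

Definition orth_proj (Ep : {set edge G}) (x : edge G -> R) (N : Omega1 -> Prop)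
    (a : Omega1) : Omega1 :=
  (* likewise, the projection onto a subspace exists and is unique *)
  xget 0 [set b | N b /\ forall c, N c -> inner1 Ep x c (a - b) = 0]%classic.

Definition Pi_ker_dstar (Ep : {set edge G}) (x : edge G -> R) :=
  orth_proj Ep x (fun a => dstar Ep x a = 0).

Definition J1 (x : edge G -> R) : Omega_1 -> Omega1 :=
  plift conj (plift intr (fun e => (iota (x e))^-1 *: estar e) : C1 G -> Omega1).

Definition det_cycles k (z : 'I_k -> C1 G) : ext Omega_1 k :=
  wedge [ffun i => tens1 K (z i)].

(* e*_1 /\ ... /\ e*_k for S = {e_1 < ... < e_k} *)
Definition estarS (le : rel (edge G)) k (S : {set edge G}) : ext Omega1 k :=
  wedge [ffun i : 'I_k => (map estar (sort le (enum S)))`_i].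

Lemma estarN e : estar (einv e) = - estar e.
Proof.
apply/val_inj/funext => c.
have -> : val (- estar e) c = - (estar e c) by rewrite raddfN.
rewrite /= /plift /freelift -sumrN; apply: eq_bigr => f _.
by rewrite einvK -scalerN opprB.
Qed.

Lemma J1_ech (x : edge G -> R) e : (forall f, x (einv f) = x f) ->
  J1 x (tens1 K (ech e)) = (iota (x e))^-1 *: estar e.
Proof.
move=> xrev.
have h r : C1_rel r ->
    freelift intr (fun f => (iota (x f))^-1 *: estar f) r = 0.
  by apply: C1_rel0 => f; rewrite xrev estarN scalerN.
rewrite /J1 plift_gen; last first.
  move=> r [b [c ->]]; rewrite !freeliftB !freeliftU (pliftD h).
  by rewrite addrAC addrK subrr.
exact: (plift_gen h).
Qed.

End Forms.

Arguments J1 {G R} F x.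
Arguments det_cycles {G} R F {k} z.
Arguments estarS {G} R F le k S.
Arguments Pi_ker_dstar {G R} F Ep x.

(* Main.v *)
(** The tensor square of a wedge [z_1 /\ ... /\ z_k] has the products of two
    [k]-minors as coordinates, so the statement amounts to the identity
    [sum_K x^K det(Z^K_I) det(Z^K_J) = T(x) x^I det(P_IJ)], where
    [P = 1 - D^T L^-1 D X] is the matrix of the projection on [ker d*], [D] is
    the incidence matrix with the row of a root removed, [X] the diagonal matrix
    of the weights and [L = D X D^T] the reduced Laplacian.  If [K] is connected
    with first Betti number [k], completing a basis of [Z_1(K)] by paths to the
    root gives a unimodular matrix, and [det(Z^K_I)] is, up to a sign depending
    only on [K], the determinant of [D] restricted to [K] and stacked over the
    rows of the identity indexed by [I]; for the other [K] with as many edges,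
    this determinant vanishes.  The Cauchy-Binet formula then turns the sum over
    [K] into the determinant of the block matrix
    [[L, D X_J], [X_I D^T, X_IJ]], which a Schur complement evaluates to
    [det L * x^I * det(P_IJ)].  The case [k = 0] is [T(x) = det L]. *)

Require Import Defs.
From mathcomp Require Import ring_quotient freeg complex.
From mathcomp Require Import boolp classical_sets reals.
From mathcomp Require Import all_boot all_order all_fingroup all_algebra ring.

Set Implicit Arguments.
Unset Strict Implicit.
Unset Printing Implicit Defensive.

Import Order.TTheory GRing.Theory Num.Theory.
Local Open Scope ring_scope.
Local Open Scope quotient_scope.

(** * Alternating maps and the Cauchy-Binet formula *)

Section Multilinear.
Variables (K : comNzRingType) (V M : lmodType K).
Implicit Type k : nat.

Definition multilinear k (F : {ffun 'I_k -> V} -> M) :=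
  forall (v : {ffun 'I_k -> V}) i a u w,
    F (upd v i (a *: u + w)) = a *: F (upd v i u) + F (upd v i w).

Definition alternating k (F : {ffun 'I_k -> V} -> M) :=
  forall (v : {ffun 'I_k -> V}) i j, i != j -> v i = v j -> F v = 0.

Lemma multilinear0 k (F : {ffun 'I_k -> V} -> M) v i :
  multilinear F -> F (upd v i 0) = 0.
Proof.
move=> Fl; have := Fl v i (-1) 0 0.
by rewrite scaler0 addr0 scaleN1r addNr.
Qed.

Lemma multilinear_sum k (F : {ffun 'I_k -> V} -> M) v i (J : finType)
    (c : J -> K) (b : J -> V) : multilinear F ->
  F (upd v i (\sum_j c j *: b j)) = \sum_j c j *: F (upd v i (b j)).
Proof.
move=> Fl; elim: (index_enum J) => [|j s IHs].
  by rewrite !big_nil multilinear0.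
by rewrite !big_cons Fl IHs.
Qed.

Definition ffcons (T : Type) k (u : T) (v : {ffun 'I_k -> T}) :
    {ffun 'I_k.+1 -> T} :=
  [ffun i => if unlift ord0 i is Some j then v j else u].

Lemma ffcons0 (T : Type) k (u : T) (v : {ffun 'I_k -> T}) :
  ffcons u v ord0 = u.
Proof. by rewrite ffunE unlift_none. Qed.

Lemma ffconsS (T : Type) k (u : T) (v : {ffun 'I_k -> T}) i :
  ffcons u v (lift ord0 i) = v i.
Proof. by rewrite ffunE liftK. Qed.

Lemma ffcons_upd0 k (u w : V) (v : {ffun 'I_k -> V}) :
  ffcons u v = upd (ffcons w v) ord0 u.
Proof.
apply/ffunP=> i; rewrite [RHS]ffunE; case: (unliftP ord0 i) => [j|] ->.
  by rewrite !ffconsS eq_sym (negPf (neq_lift _ _)).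
by rewrite ffcons0 eqxx.
Qed.

Lemma ffcons_updS k (u w : V) (v : {ffun 'I_k -> V}) i :
  ffcons u (upd v i w) = upd (ffcons u v) (lift ord0 i) w.
Proof.
apply/ffunP=> j; rewrite [RHS]ffunE; case: (unliftP ord0 j) => [l|] ->.
  by rewrite !ffconsS ffunE (inj_eq lift_inj).
by rewrite !ffcons0 (negPf (neq_lift _ _)).
Qed.

Lemma sum_ffcons (U : nmodType) k (J : finType) (H : {ffun 'I_k.+1 -> J} -> U) :
  \sum_g H g = \sum_j \sum_g H (ffcons j g).
Proof.
rewrite pair_big /=.
rewrite (reindex (fun p : J * {ffun 'I_k -> J} => ffcons p.1 p.2)) //=.
exists (fun g => (g ord0, [ffun i => g (lift ord0 i)])) => [[j g]|g] _ /=.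
  rewrite ffcons0; congr pair; apply/ffunP=> i.
  by rewrite ffunE ffconsS.
apply/ffunP=> i; case: (unliftP ord0 i) => [j|] ->.
  by rewrite ffconsS ffunE.
by rewrite ffcons0.
Qed.

(** Induction on the number of arguments: the first one is expanded by linearity, and once it is
    frozen at [b j] the map is multilinear in the remaining arguments. *)
Lemma multilinear_expand k (F : {ffun 'I_k -> V} -> M) (J : finType)
    (A : 'I_k -> J -> K) (b : J -> V) : multilinear F ->
  F [ffun i => \sum_j A i j *: b j] =
  \sum_(g : {ffun 'I_k -> J}) (\prod_i A i (g i)) *: F [ffun i => b (g i)].
Proof.
elim: k F A => [|k IHk] F A Fl.
  rewrite (eq_bigr (fun=> F [ffun i => \sum_j A i j *: b j])) => [|g _].
    by rewrite sumr_const card_ffun card_ord expn0 mulr1n.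
  by rewrite big_ord0 scale1r; congr F; apply/ffunP => -[].
rewrite sum_ffcons.
pose A' i := A (lift ord0 i).
have -> : [ffun i => \sum_j A i j *: b j] =
   ffcons (\sum_j A ord0 j *: b j) [ffun i => \sum_j A' i j *: b j].
  apply/ffunP=> i; rewrite ffunE; case: (unliftP ord0 i) => [j|] ->.
    by rewrite ffconsS ffunE.
  by rewrite ffcons0.
rewrite (ffcons_upd0 _ 0) multilinear_sum //; apply: eq_bigr => j _.
rewrite -ffcons_upd0 (IHk (fun v => F (ffcons (b j) v))); last first.
  by move=> v i a u w; rewrite !ffcons_updS Fl.
rewrite scaler_sumr; apply: eq_bigr => g _.
rewrite scalerA big_ord_recl ffcons0; congr (_ * _ *: F _).
  by apply: eq_bigr => i _; rewrite ffconsS.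
apply/ffunP=> i; rewrite [RHS]ffunE; case: (unliftP ord0 i) => [l|] ->.
  by rewrite !ffconsS ffunE.
by rewrite !ffcons0.
Qed.

(** Polarization: with [v i + v j] at both places [i] and [j], the value of [F] is zero, and
    expanding it leaves only the two cross terms. *)
Lemma alternating_tperm k (F : {ffun 'I_k -> V} -> M)
    (v : {ffun 'I_k -> V}) i j :
  multilinear F -> alternating F -> i != j ->
  F [ffun l => v (tperm i j l)] = - F v.
Proof.
move=> Fl Fa ij; apply/eqP; rewrite -addr_eq0.
(* The family [v] with [a] at place [i] and [b] at place [j]. *)
pose w a b := upd (upd v i a) j b.
have wE a b l : w a b l = if l == j then b else if l == i then a else v l.
  by rewrite !ffunE.
have w1 a b c : F (w (a + b) c) = F (w a c) + F (w b c).
  have wC d : w d c = upd (upd v j c) i d.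
    apply/ffunP=> l; rewrite wE !ffunE.
    by case: eqP => // ->; rewrite eq_sym (negPf ij).
  by rewrite !wC -[a]scale1r Fl !scale1r.
have w2 a b c : F (w a (b + c)) = F (w a b) + F (w a c).
  by rewrite /w -[b]scale1r Fl !scale1r.
have w0 a : F (w a a) = 0.
  by apply: (Fa _ i j) => //; rewrite !wE !eqxx (negPf ij).
have ->: [ffun l => v (tperm i j l)] = w (v j) (v i).
  apply/ffunP=> l; rewrite wE ffunE.
  case: tpermP => [->|->|/eqP/negPf -> /eqP/negPf -> //]; rewrite ?eqxx //.
  by rewrite (negPf ij).
have ew: v = w (v i) (v j).
  by apply/ffunP=> l; rewrite wE; case: eqP => [->//|_]; case: eqP => [->|].
rewrite [in F v]ew addrC.
by have := w0 (v i + v j); rewrite w1 !w2 !w0 add0r addr0 => ->.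
Qed.

Lemma alternating_perm k (F : {ffun 'I_k -> V} -> M)
    (v : {ffun 'I_k -> V}) (s : 'S_k) :
  multilinear F -> alternating F ->
  F [ffun l => v (s l)] = (-1) ^+ s *: F v.
Proof.
move=> Fl Fa; case: (prod_tpermP s) => ts -> {s}.
elim: ts v => [|[i j] ts IHts] v /=.
  move=> _; rewrite big_nil odd_perm1 scale1r; congr F.
  by apply/ffunP=> l; rewrite ffunE perm1.
case/andP=> ij /IHts{}IHts; rewrite big_cons odd_mul_tperm ij.
have -> : [ffun l => v ((tperm i j * \prod_(t <- ts) tperm t.1 t.2)%g l)] =
    [ffun l => [ffun l' => v ((\prod_(t <- ts) tperm t.1 t.2)%g l')]
       (tperm i j l)].
  by apply/ffunP=> l; rewrite !ffunE permM.
rewrite alternating_tperm // IHts signr_addb mulN1r scaleNr //.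
Qed.

(* Summing over all maps [g], instead of over subsets, costs a factor [k!]. *)
Lemma alternating_expand k (F : {ffun 'I_k -> V} -> M) (J : finType)
    (A : 'I_k -> J -> K) (b : J -> V) : multilinear F -> alternating F ->
  F [ffun i => \sum_j A i j *: b j] *+ k`! =
  \sum_(g : {ffun 'I_k -> J})
     \det (\matrix_(i, j) A i (g j)) *: F [ffun i => b (g i)].
Proof.
move=> Fl Fa.
under [RHS]eq_bigr do rewrite scaler_suml.
(* The [k!] copies on the left are indexed by permutations: the Leibniz term of [s] is the full
   multilinear expansion reindexed by composing [g] with [s], whose sign comes from alternation. *)
rewrite exchange_big /= -[in LHS]card_Sn -sumr_const.
apply: eq_big => [|s _]; first by move=> s; rewrite ?inE.
rewrite multilinear_expand //.
rewrite (reindex_inj (h := fun g : {ffun 'I_k -> J} => [ffun i => g (s i)])).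
  apply: eq_bigr => g _ /=.
  have -> : [ffun i => b ([ffun i => g (s i)] i)] =
      [ffun i => [ffun i' => b (g i')] (s i)].
    by apply/ffunP=> i; rewrite !ffunE.
  rewrite alternating_perm // scalerA mulrC; congr (_ * _ *: _).
  by apply: eq_bigr => i _; rewrite ffunE mxE.
move=> g1 g2 /ffunP eg; apply/ffunP=> i.
by have := eg (s^-1%g i); rewrite !ffunE permKV.
Qed.

End Multilinear.

(** A determinant is alternating and multilinear in its rows, and row [i] of the product matrix
    combines the vectors [(B j e)_j] with coefficients [A i e], so [alternating_expand] applies. *)
Lemma cauchy_binet (R : comNzRingType) k (J : finType) (A B : 'I_k -> J -> R) :
  \det (\matrix_(i, j) \sum_e A i e * B j e) *+ k`! =
  \sum_(g : {ffun 'I_k -> J})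
    \det (\matrix_(i, j) A i (g j)) * \det (\matrix_(i, j) B i (g j)).
Proof.
pose F (v : {ffun 'I_k -> 'rV[R]_k}) : R^o := \det (\matrix_(i, j) v i 0 j).
have Fl : multilinear F.
  move=> v i a u w; rewrite /F /=.
  rewrite (determinant_multilinear (i0 := i) (b := a) (c := 1)
    (B := \matrix_(l, j) upd v i u l 0 j)
    (C := \matrix_(l, j) upd v i w l 0 j)) ?mul1r //.
  - by apply/rowP=> j; rewrite !mxE !ffunE eqxx !mxE mul1r.
  - by apply/matrixP=> l j; rewrite !mxE !ffunE eq_sym (negPf (neq_lift _ _)).
  - by apply/matrixP=> l j; rewrite !mxE !ffunE eq_sym (negPf (neq_lift _ _)).
have Fa : alternating F.
  move=> v i j ij vij; apply: (determinant_alternate ij) => l.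
  by rewrite !mxE vij.
have := alternating_expand A (fun e => \row_j B j e) Fl Fa.
rewrite /F.
have -> : \matrix_(i, j) [ffun i => \sum_e A i e *: \row_j B j e] i 0 j =
    \matrix_(i, j) \sum_e A i e * B j e.
  apply/matrixP=> i j; rewrite !mxE ffunE summxE.
  by apply: eq_bigr => e _; rewrite !mxE.
move=> ->; apply: eq_bigr => g _; congr (_ * _).
by rewrite -det_tr; congr (\det _); apply/matrixP=> i j; rewrite !mxE ffunE mxE.
Qed.

(** * Chains and cycles *)

Section Chains.
Variable G : graph.
Implicit Types (e f : edge G) (v : vertex G) (c : C1 G) (S Ep : {set edge G}).

(** The coefficient of [v] in the boundary of [e]; a loop gets 0. *)
Definition inc v e : int := (tgt e == v)%:R - (src e == v)%:R.

(** The coordinate of a chain along [e]. Both orientations are counted, with opposite signs, so that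
    the relations of [C1] are killed. *)
Definition ecoef e : C1 G -> int :=
  plift intr (fun f => (f == e)%:R - (f == einv e)%:R : int^o).

Lemma ecoef_rev e f : (einv f == e)%:R - (einv f == einv e)%:R
  = - ((f == e)%:R - (f == einv e)%:R) :> int^o.
Proof.
by rewrite (can2_eq (@einvK G) (@einvK G)) (inj_eq (can_inj (@einvK G))) opprB.
Qed.

Lemma ecoef_linear e a c d : ecoef e (a *: c + d) = a * ecoef e c + ecoef e d.
Proof.
rewrite /ecoef plift_semilin => [|r /C1_rel0]; last by apply; exact: ecoef_rev.
by rewrite /= intz.
Qed.

Lemma ecoefB e c d : ecoef e (c - d) = ecoef e c - ecoef e d.
Proof. by rewrite addrC -scaleN1r ecoef_linear mulN1r addrC. Qed.

Lemma ecoef0 e : ecoef e 0 = 0.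
Proof. by rewrite -(subrr 0) ecoefB subrr. Qed.

Lemma ecoefD e c d : ecoef e (c + d) = ecoef e c + ecoef e d.
Proof. by rewrite -[c]scale1r ecoef_linear mul1r scale1r. Qed.

Lemma ecoefZ e a c : ecoef e (a *: c) = a * ecoef e c.
Proof. by rewrite -[a *: c]addr0 ecoef_linear ecoef0 addr0. Qed.

Lemma ecoef_sum e (I : Type) (r : seq I) (P : pred I) (C : I -> C1 G) :
  ecoef e (\sum_(i <- r | P i) C i) = \sum_(i <- r | P i) ecoef e (C i).
Proof. exact: (big_morph (ecoef e) (ecoefD e) (ecoef0 e)). Qed.

Lemma ecoef_ech e f : ecoef e (ech f) = (f == e)%:R - (f == einv e)%:R.
Proof.
by rewrite /ecoef plift_gen // => r /C1_rel0; apply; exact: ecoef_rev.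
Qed.

Lemma ech_einv e : ech (einv e) = - ech e.
Proof.
apply/eqP; rewrite -addr_eq0 addrC /ech /pgen -pres_piD; apply/eqP.
rewrite -[RHS](raddf0 (\pi_(Quotient.quot (relspan (@C1_rel G))))).
apply/eqP; rewrite pres_pi_eq subr0; apply: relspan_rel.
by exists e.
Qed.

Lemma chain_span c : exists a : edge G -> int, c = \sum_e a e *: ech e.
Proof.
exists (fun e => coeff e (pres_repr c)); rewrite -{1}[c]pres_reprK pres_piE.
rewrite big_uniq ?uniq_dom //= big_mkcond; apply: eq_bigr => e _.
by case: ifPn => // /coeff_outdom ->; rewrite scale0r.
Qed.

Lemma bd_linear a c d : bd (a *: c + d) = a *: bd c + bd d.
Proof.
rewrite /bd plift_semilin //= => r [e ->].
by rewrite freeliftD !freeliftU src_einv tgt_einv addrC subrKA addrN.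
Qed.

Lemma bd0 : bd (0 : C1 G) = 0.
Proof. by have := bd_linear (-1) 0 0; rewrite !scaleN1r !oppr0 addr0 addNr. Qed.

Lemma bdD c d : bd (c + d) = bd c + bd d.
Proof. by rewrite -[c]scale1r bd_linear !scale1r. Qed.

Lemma bdZ a c : bd (a *: c) = a *: bd c.
Proof. by rewrite -[a *: c]addr0 bd_linear bd0 addr0. Qed.

Lemma bd_sum (I : Type) (r : seq I) (P : pred I) (C : I -> C1 G) :
  bd (\sum_(i <- r | P i) C i) = \sum_(i <- r | P i) bd (C i).
Proof. exact: (big_morph bd bdD bd0). Qed.

Lemma coeff_bd_ech v e : coeff v (bd (ech e)) = inc v e.
Proof. by rewrite bd_ech coeffB !coeffU !mul1r. Qed.

Lemma is_subgraph_einv S e : is_subgraph S -> (einv e \in S) = (e \in S).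
Proof.
move/forall_inP=> Ss; apply/idP/idP => /Ss //.
by rewrite einvK.
Qed.

Lemma ecoef_ech_notin S e f : is_subgraph S -> f \in S -> e \notin S ->
  ecoef e (ech f) = 0.
Proof.
move=> sS fS eS; have fe : (f == e) = false.
  by apply: contraNF eS => /eqP <-.
have fe' : (f == einv e) = false.
  by apply: contraNF eS => /eqP fe'; rewrite -(is_subgraph_einv _ sS) -fe'.
by rewrite ecoef_ech fe fe' subrr.
Qed.

Section Orientation.
Variable Ep : {set edge G}.
Hypothesis orE : is_orientation Ep.

Lemma orientedN e : (einv e \in Ep) = (e \notin Ep).
Proof. by have := orE e; do 2!case: (_ \in Ep). Qed.

Lemma ecoef_ech_oriented e f : e \in Ep -> f \in Ep ->
  ecoef e (ech f) = (f == e)%:R.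
Proof.
move=> eE fE; rewrite ecoef_ech (_ : f == einv e = false) ?subr0 //.
by apply: contraTF fE => /eqP->; rewrite orientedN negbK.
Qed.

(** With [chain_eq], this makes the edges of [Ep] a basis of [C1]. It is enough to check generators,
    and an edge outside [Ep] is the opposite of one inside. *)
Lemma chainE c : c = \sum_(e in Ep) ecoef e c *: ech e.
Proof.
have E f : ech f = \sum_(e in Ep) ecoef e (ech f) *: ech e.
  have aux g : g \in Ep -> ech g = \sum_(e in Ep) ecoef e (ech g) *: ech e.
    move=> gE; rewrite (bigD1 g) //= ecoef_ech_oriented // eqxx scale1r.
    rewrite big1 ?addr0 // => e /andP[eE eg].
    by rewrite ecoef_ech_oriented // eq_sym (negPf eg) scale0r.
  have [/aux //|fE] := boolP (f \in Ep).
  have /aux : einv f \in Ep by rewrite orientedN.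
  rewrite ech_einv => /(congr1 -%R); rewrite opprK => {1}->.
  rewrite -sumrN; apply: eq_bigr => e _.
  by rewrite -scaleNr -[- ech f]sub0r ecoefB ecoef0 sub0r opprK.
have [a ca] := chain_span c; rewrite {1}ca.
under eq_bigr => f _ do rewrite E scaler_sumr.
rewrite exchange_big /=; apply: eq_bigr => e _.
rewrite ca ecoef_sum scaler_suml; apply: eq_bigr => f _.
by rewrite scalerA ecoefZ.
Qed.

Lemma coeff_bd v c : coeff v (bd c) = \sum_(e in Ep) ecoef e c * inc v e.
Proof.
rewrite [in LHS](chainE c) bd_sum (raddf_sum (coeff v)) /=.
by apply: eq_bigr => e _; rewrite bdZ coeffZ coeff_bd_ech.
Qed.

Lemma chain_eq c d : {in Ep, forall e, ecoef e c = ecoef e d} -> c = d.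
Proof.
move=> cd; rewrite (chainE c) (chainE d).
by apply: eq_bigr => e eE; rewrite cd.
Qed.

Lemma Z1P S c : is_subgraph S ->
  Z1 S c <-> {in Ep, forall e, e \notin S -> ecoef e c = 0} /\ bd c = 0.
Proof.
move=> sS; split=> [[[a ->] ->]|[cS b0]].
  split=> // e eE eS; rewrite ecoef_sum big1 // => f fS.
  by rewrite ecoefZ (ecoef_ech_notin sS fS eS) mulr0.
split=> //; exists (fun e => if e \in Ep then ecoef e c else 0).
rewrite {1}(chainE c) [LHS]big_mkcond [RHS]big_mkcond; apply: eq_bigr => e _.
case: ifPn => eE; case: ifPn => eS //=; last by rewrite scale0r.
by rewrite cS // scale0r.
Qed.

End Orientation.

(** Add up the edges of a path from [v] to [w]: the boundary telescopes. *)
Lemma connected_chain S v w : is_subgraph S -> connected S ->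
  exists2 c : C1 G, forall e, e \notin S -> ecoef e c = 0
                  & forall u, coeff u (bd c) = (w == u)%:R - (v == u)%:R.
Proof.
move=> sS /andP[_ /forallP/(_ v)/forallP/(_ w)/connectP[p]].
elim: p v => [|u p IHp] v /=.
  move=> _ ->; exists 0 => [e _|u]; first exact: ecoef0.
  by rewrite bd0 coeff0 subrr.
case/andP=> /exists_inP[e eS /andP[/eqP eu /eqP ew]] /IHp{}IHp /IHp[c cS cb].
exists (ech e + c) => [f fS|u'].
  by rewrite ecoefD cS // addr0 (ecoef_ech_notin sS).
by rewrite bdD coeffD cb coeff_bd_ech /inc eu ew addrC subrKA.
Qed.

(** The cut condition is applied to the set of vertices that cannot be reached from [v0]: no edge of
    [S] enters or leaves it. *)
Lemma connected_cut S v0 : is_subgraph S ->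
  (forall U : {set vertex G}, v0 \notin U ->
     {in S, forall e, (tgt e \in U) = (src e \in U)} -> U = set0) ->
  connected S.
Proof.
move=> sS cut; apply/andP; split; first by apply/card_gt0P; exists v0.
have adjS u v : adj S u v -> adj S v u.
  case/exists_inP=> e eS /andP[eu ev]; apply/exists_inP; exists (einv e).
    by rewrite is_subgraph_einv.
  by rewrite src_einv tgt_einv eu ev.
have symS : connect_sym (adj S).
  by apply: sym_connect_sym => u v; apply/idP/idP; apply: adjS.
have con v : connect (adj S) v0 v.
  apply/negPn/negP=> nv.
  have := cut [set u | ~~ connect (adj S) v0 u].
  rewrite inE connect0 => /(_ isT) E.
  suff /E/setP/(_ v) : {in S, forall e, (tgt e \in
      [set u | ~~ connect (adj S) v0 u]) =
      (src e \in [set u | ~~ connect (adj S) v0 u])} by rewrite !inE nv.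
  move=> e eS; rewrite !inE; congr (~~ _); apply: (same_connect_r symS).
  by rewrite symS connect1 //; apply/exists_inP; exists e; rewrite ?eqxx.
apply/forallP=> u; apply/forallP=> v; apply: connect_trans (con v).
by rewrite symS.
Qed.

End Chains.

(** * Acyclic subgraphs *)

(** By the pigeonhole principle the orbit of [x0] meets itself. A point with the shortest possible
    return time [d.+1] runs through a cycle without repetition. *)
Lemma exists_fcycle (T : finType) (f : T -> T) (P : pred T) (x0 : T) :
  P x0 -> (forall x, P x -> P (f x)) ->
  exists p : seq T, [/\ p != [::], all P p, uniq p & fcycle f p].
Proof.
move=> Px0 fP.
have iterP n : P (iter n f x0) by elim: n => //= n /fP.
have ret : exists d, [exists x, P x && (iter d.+1 f x == x)].
  have : ~~ injectiveb (fun i : 'I_#|T|.+1 => iter i f x0).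
    by apply/negP => /injectiveP/leq_card; rewrite card_ord ltnn.
  case/injectivePn => i [j ij eij].
  wlog lij : i j ij eij / (i < j)%N.
    have ji : j != i by rewrite eq_sym.
    have eji : iter j f x0 = iter i f x0 by rewrite eij.
    move=> wl; have [lij|lji|/val_inj eij'] := ltngtP i j.
    - exact: (wl i j).
    - exact: (wl j i).
    - by case/eqP: ij.
  exists (j - i).-1; apply/existsP; exists (iter i f x0).
  by rewrite iterP prednK ?subn_gt0 // -iterD subnK 1?ltnW // -eij eqxx.
have [d /existsP[x /andP[Px /eqP fx]] dmin] := ex_minnP ret.
have itP n : P (iter n f x) by elim: n => //= n /fP.
exists (traject f x d.+1); split=> //.
- by apply/allP=> _ /trajectP[i _ ->].
- rewrite looping_uniq; apply/negP => /trajectP[i lid ei].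
  have : (d <= d - i.+1)%N.
    apply: dmin; apply/existsP; exists (iter i f x).
    by rewrite itP subnSK // -iterD subnK 1?ltnW // -ei eqxx.
  by rewrite leqNgt ltn_subrL /= (leq_ltn_trans _ lid).
- rewrite /= -[X in rcons _ X]fx iterSr -trajectSr.
  by rewrite fpath_traject.
Qed.

Section Betti.
Variable G : graph.
Implicit Types (e f : edge G) (v : vertex G) (c : C1 G) (S Ep : {set edge G}).

Lemma ecoef_einv e c : ecoef (einv e) c = - ecoef e c.
Proof.
have [a ->] := chain_span c; rewrite !ecoef_sum -sumrN.
by apply: eq_bigr => f _; rewrite !ecoefZ !ecoef_ech einvK -mulrN opprB.
Qed.

(** An edge of [Ep] that ends at [v] leaves [v] through its inverse, with the opposite
    coordinate. *)
Lemma ecoef_outflow Ep v c : is_orientation Ep ->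
  \sum_(e | src e == v) ecoef e c = - coeff v (bd c).
Proof.
move=> orE; rewrite (coeff_bd orE) -sumrN (bigID (mem Ep)) /=.
have -> : \sum_(e | (src e == v) && (e \notin Ep)) ecoef e c =
          \sum_(e in Ep | tgt e == v) - ecoef e c.
  rewrite (reindex_inj (inv_inj (@einvK G))) /=.
  apply: eq_big => [e|e _]; last by rewrite ecoef_einv.
  by rewrite src_einv orientedN // negbK andbC.
rewrite [X in X + _](_ : _ = \sum_(e in Ep | src e == v) ecoef e c); last first.
  by apply: eq_bigl => e; rewrite andbC.
rewrite !big_mkcondr -big_split; apply: eq_bigr => e _ /=.
by rewrite /inc; do 2!case: eqP => _ /=; ring.
Qed.

Lemma first_betti0 S : first_betti S 0 <-> forall c, Z1 S c -> c = 0.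
Proof.
split=> [[z [_ zb]] c /zb[a [-> _]]|Z0]; first by rewrite big_ord0.
exists (fun=> 0); split=> [[]//|c /Z0 ->]; exists [ffun=> 0].
by split=> [|a _]; [rewrite big_ord0|apply/ffunP=> -[]].
Qed.

(** The boundary telescopes around the circuit. The sum is nonzero because each edge occurs once and
    never together with its inverse. *)
Lemma circuit_cycle S p : is_subgraph S -> circuit S p ->
  Z1 S (\sum_(e <- p) ech e) /\ \sum_(e <- p) ech e <> 0.
Proof.
move=> sS /and4P[p0 /allP pS up cp].
have srcI : {in p &, injective src}.
  move=> e f ep fp ef; rewrite -(nth_index e ep) -(nth_index e fp); congr nth.
  have := nth_uniq (src e) _ _ up; rewrite size_map.
  move=> /(_ (index e p) (index f p)).
  rewrite !index_mem !(nth_map e) ?index_mem // !nth_index // ef eqxx.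
  by move=> /(_ ep fp)/esym/eqP.
(* The inverse of [e] has the same source as the successor of [e], so on the circuit it would be
   that successor, which non-backtracking excludes. *)
have pN e : e \in p -> einv e \notin p.
  move=> ep; apply/negP => e'p; have /andP[/eqP es] := next_cycle cp ep.
  move/eqP; apply; apply: srcI => //; first by rewrite mem_next.
  by rewrite -es src_einv.
split.
  split; last first.
    rewrite bd_sum.
    rewrite (eq_bigr (fun e => << tgt e >> - << src e >> : C0 G)) => [|e _].
      case: p cp {p0 pS up srcI pN} => [|e p] /=; first by rewrite big_nil.
      rewrite rcons_path => /andP[ep /andP[/eqP le _]].
      suff -> : \sum_(f <- e :: p) (<< tgt f >> - << src f >> : C0 G)
          = << tgt (last e p) >> - << src e >> by rewrite le subrr.
      elim: p e ep {le} => [|f p IHp] e /=; first by rewrite big_seq1.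
      case/andP=> /andP[/eqP ef _] /IHp{}IHp; rewrite big_cons {}IHp.
      by rewrite ef addrC subrKA.
    exact: bd_ech.
  exists (fun e => (e \in p)%:R).
  rewrite big_uniq ?(map_uniq up) //= big_mkcond [RHS]big_mkcond.
  apply: eq_bigr => e _; case: ifPn => [ep|_].
    by rewrite (pS e ep : e \in S) scale1r.
  by rewrite scale0r if_same.
case: p p0 {cp pS} up srcI pN => // e p _ up _ pN.
move=> /(congr1 (ecoef e)); rewrite ecoef0 big_cons ecoefD ecoef_sum.
rewrite ecoef_ech eqxx eq_sym (negPf (einv_neq e)) subr0.
rewrite big_seq big1 => [//|f fp].
rewrite ecoef_ech; have fe : (f == e) = false.
  by apply: contraTF up => /eqP <-; rewrite /= (map_f src fp).
have fe' : (f == einv e) = false.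
  apply: contraTF fp => /eqP ->; have := pN e (mem_head _ _).
  by rewrite inE negb_or => /andP[].
by rewrite fe fe' subrr.
Qed.

(** A nonzero cycle is a conserved flow: every edge with positive coordinate is followed by another
    one, and walking along such edges ends in a circuit. *)
Lemma acyclic_Z1 Ep S c : is_orientation Ep -> is_subgraph S ->
  acyclic S -> Z1 S c -> c = 0.
Proof.
move=> orE sS acS /(Z1P orE c sS)[cS c0].
have cS' e : e \notin S -> ecoef e c = 0.
  move=> eS; have [eE|] := boolP (e \in Ep); first exact: cS.
  rewrite -(orientedN orE) => /cS; rewrite is_subgraph_einv // => /(_ eS).
  by rewrite ecoef_einv => /eqP; rewrite oppr_eq0 => /eqP.
apply/eqP/negPn/negP => nc.
have [e0 e0c] : exists e, 0 < ecoef e c.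
  apply/existsP; apply: contraNT nc; rewrite negb_exists => /forallP c_le0.
  apply/eqP/(chain_eq orE) => e _; rewrite ecoef0.
  have := c_le0 e; have := c_le0 (einv e).
  rewrite ecoef_einv -!leNgt oppr_le0 => ge0 le0.
  by apply/eqP; rewrite eq_le ge0 le0.
pose out v := [pick e | (src e == v) && (0 < ecoef e c)].
(* The edge [einv e] leaves [tgt e] with a negative coordinate while the total outflow is zero, so
   some other edge leaves with a positive one. *)
have outP e : 0 < ecoef e c -> exists2 f, out (tgt e) = Some f &
    (src f == tgt e) && (0 < ecoef f c).
  move=> ec; rewrite /out; case: pickP => [f|noout]; first by exists f.
  have := ecoef_outflow (tgt e) c orE; rewrite c0 coeff0 oppr0.
  rewrite (bigD1 (einv e)) ?src_einv //= ecoef_einv => /eqP.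
  rewrite addrC subr_eq0 => /eqP se; have : ecoef e c <= 0.
    rewrite -se; apply: sumr_le0 => f /andP[fe _].
    by have := noout f; rewrite fe /= leNgt => ->.
  by rewrite leNgt ec.
(* The successor depends only on the target of [e], so two edges of a cycle of [nxt] with the same
   source are equal. *)
pose nxt e := odflt e (out (tgt e)).
have nxtP e : 0 < ecoef e c -> (src (nxt e) == tgt e) && (0 < ecoef (nxt e) c).
  by rewrite /nxt => /outP[f ->].
have nxt_src e f : 0 < ecoef e c -> 0 < ecoef f c -> tgt e = tgt f ->
    nxt e = nxt f.
  by rewrite /nxt => /outP[g eg _] _ <-; rewrite eg.
have [p [p0 /allP pc up cp]] := exists_fcycle (P := fun e => 0 < ecoef e c) e0c
  (fun e ec => (proj2 (andP (nxtP e ec)))).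
have := acS p; rewrite /circuit p0 /=; apply/negP; rewrite negbK.
apply/and3P; split.
- apply/allP=> e /pc ec; apply: contraTT ec => eS.
  by rewrite /= cS' ?ltxx.
- rewrite map_inj_in_uniq // => e f ep fp ef.
  have ee := prev_cycle cp ep; have ff := prev_cycle cp fp.
  rewrite -(eqP ee) -(eqP ff); apply: nxt_src; rewrite ?pc ?mem_prev //.
  have /nxtP/andP[/eqP <- _] := pc _ (etrans (mem_prev p e) ep).
  have /nxtP/andP[/eqP <- _] := pc _ (etrans (mem_prev p f) fp).
  by rewrite (eqP ee) (eqP ff).
- apply: (sub_in_cycle (P := fun e => 0 < ecoef e c)) cp; last exact/allP.
  move=> e f ec fc /eqP <-; have /andP[/eqP -> nc'] := nxtP e ec.
  rewrite eqxx /=; apply: contraTN nc' => /eqP ->.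
  by rewrite ecoef_einv oppr_gt0 -leNgt ltW.
Qed.

(** Acyclicity means that the only cycle is zero; this turns the tree sum into the case [k = 0] of
    the sum over connected subgraphs. *)
Lemma spanning_trees_betti0 Ep : is_orientation Ep ->
  spanning_trees G = conn_subgraphs G 0.
Proof.
move=> orE; apply/setP=> S; rewrite !inE.
have [sS|//] := boolP (is_subgraph S); congr [&& _, _ & _].
apply/asboolP/asboolP => [acS|/first_betti0 Z0 p].
  by apply/first_betti0 => c; apply: acyclic_Z1 orE sS acS.
by apply/negP => /(circuit_cycle sS)[/Z0].
Qed.

End Betti.

(** * Incidence matrices and cycle bases *)

(** The adjugate stands in for an inverse, since over the integers a nonzero determinant need not be
    a unit. *)
Lemma mulmx_det_eq0 (R : idomainType) n p (A : 'M[R]_n) (u : 'M[R]_(p, n)) :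
  \det A != 0 -> u *m A = 0 -> u = 0.
Proof.
move=> dA uA; have : u *m (A *m \adj A) = 0 by rewrite mulmxA uA mul0mx.
rewrite mul_mx_adj mul_mx_scalar => /eqP; rewrite scalemx_eq0 (negPf dA) /=.
by move/eqP.
Qed.

Lemma mulmx_det_eq0r (R : idomainType) n p (A : 'M[R]_n) (u : 'M[R]_(n, p)) :
  \det A != 0 -> A *m u = 0 -> u = 0.
Proof.
rewrite -det_tr => dA /(congr1 trmx); rewrite trmx_mul trmx0.
by move=> /(mulmx_det_eq0 dA)/(congr1 trmx); rewrite trmxK trmx0.
Qed.

Section Incidence.
Variables (G : graph) (v0 : vertex G) (Ep : {set edge G}).
Hypothesis orE : is_orientation Ep.
Implicit Types (e f : edge G) (v : vertex G) (c : C1 G) (S : {set edge G}).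

Definition nroot := #|predC1 v0|.
Local Notation m := nroot.

(* The incidence matrix [D], without the row of the root. *)
Definition dinc (i : 'I_m) e : int := inc (enum_val i) e.

Lemma sum_nroot (R : nmodType) (F : vertex G -> R) :
  \sum_v F v = F v0 + \sum_(i < m) F (enum_val i).
Proof.
rewrite (bigD1 v0) //=; congr (_ + _).
by rewrite -(@big_enum_val _ _ _ _ (predC1 v0)).
Qed.

Lemma enum_val_neq (i : 'I_m) : (enum_val i == v0) = false.
Proof. by have := enum_valP i; rewrite !inE => /negPf. Qed.

Lemma sum_inc e : \sum_v inc v e = 0.
Proof.
have s1 w : \sum_v (w == v)%:R = 1 :> int.
  by rewrite (bigD1 w) //= eqxx big1 ?addr0 // => v; rewrite eq_sym => /negPf->.
by rewrite /inc sumrB !s1 subrr.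
Qed.

(** The coefficients of a boundary add up to zero, so the one at the root follows from the
    others. *)
Lemma bd_eq0 c : (forall i : 'I_m, coeff (enum_val i) (bd c) = 0) -> bd c = 0.
Proof.
move=> c0; have /eqP : \sum_v coeff v (bd c) = 0.
  under eq_bigr do rewrite (coeff_bd orE).
  rewrite exchange_big big1 //= => e _.
  by rewrite -mulr_sumr sum_inc mulr0.
rewrite sum_nroot (eq_bigr (fun=> 0)) => [|i _]; last exact: c0.
rewrite big1 // addr0 => /eqP c0'; apply/eqP/freeg_eqP => v; rewrite coeff0.
have [->//|vv0] := eqVneq v v0.
by have vin : v \in predC1 v0; [|rewrite -(enum_rankK_in vin vin) c0].
Qed.

Definition pathspec S (q : 'I_m -> C1 G) :=
  (forall i e, e \notin S -> ecoef e (q i) = 0) /\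
  (forall i v, coeff v (bd (q i)) = (enum_val i == v)%:R - (v0 == v)%:R).

Lemma pathspec_ex S : is_subgraph S -> connected S -> exists q, pathspec S q.
Proof.
move=> sS cS.
have ex (i : 'I_m) : exists c : C1 G, (forall e, e \notin S -> ecoef e c = 0) /\
    (forall v, coeff v (bd c) = (enum_val i == v)%:R - (v0 == v)%:R).
  by have [c] := connected_chain v0 (enum_val i) sS cS; exists c.
have [q qP] := choice ex.
by exists q; split=> i; case: (qP i).
Qed.

(* The cycle formed by [e] and the paths [q] from the root to its ends. *)
Definition close (q : 'I_m -> C1 G) e : C1 G := ech e - \sum_i dinc i e *: q i.

Lemma bd_close S q e : pathspec S q -> bd (close q e) = 0.
Proof.
move=> [_ qb]; apply: bd_eq0 => l.
rewrite /close addrC -scaleN1r bd_linear bd_sum coeffD coeffZ coeff_bd_ech.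
rewrite (raddf_sum (coeff (enum_val l))) /= (bigD1 l) //= bdZ coeffZ qb.
rewrite eqxx eq_sym enum_val_neq subr0 mulr1 big1 => [|i il].
  by rewrite addr0 mulN1r addNr.
rewrite bdZ coeffZ qb (inj_eq enum_val_inj) (negPf il) eq_sym enum_val_neq.
by rewrite subrr mulr0.
Qed.

Lemma ecoef_close q e f :
  ecoef f (close q e) = ecoef f (ech e) - \sum_i dinc i e * ecoef f (q i).
Proof.
rewrite ecoefB ecoef_sum; congr (_ - _).
by apply: eq_bigr => i _; rewrite ecoefZ.
Qed.

(* [D] stacked over the rows of the identity indexed by [g]. *)
Definition nrow k (g : 'I_k -> edge G) (i : 'I_(m + k)) e : int :=
  match split i with inl a => dinc a e | inr b => (g b == e)%:R end.

Lemma nrowl k (g : 'I_k -> edge G) i e : nrow g (lshift k i) e = dinc i e.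
Proof. by rewrite /nrow (unsplitK (inl i)). Qed.

Lemma nrowr k (g : 'I_k -> edge G) i e : nrow g (rshift m i) e = (g i == e)%:R.
Proof. by rewrite /nrow (unsplitK (inr i)). Qed.

Definition Nmx k p (g : 'I_k -> edge G) (h : 'I_p -> edge G) :
  'M[int]_(m + k, p) := \matrix_(i, j) nrow g i (h j).

Definition Dmx p (h : 'I_p -> edge G) : 'M[int]_(m, p) :=
  \matrix_(i, j) dinc i (h j).
Definition Imx k p (g : 'I_k -> edge G) (h : 'I_p -> edge G) : 'M[int]_(k, p) :=
  \matrix_(i, j) (g i == h j)%:R.

Lemma NmxE k p (g : 'I_k -> edge G) (h : 'I_p -> edge G) :
  Nmx g h = col_mx (Dmx h) (Imx g h).
Proof.
by apply/matrixP=> i j; rewrite !mxE /nrow; case: split => l; rewrite mxE.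
Qed.

Section Support.
Variables (S : {set edge G}) (p : nat) (h : 'I_p -> edge G).
Hypotheses (sS : is_subgraph S) (h_inj : injective h).
Hypothesis hS : S :&: Ep =i codom h.

Lemma h_oriented j : h j \in Ep.
Proof. by have := codom_f h j; rewrite -hS inE => /andP[]. Qed.

Lemma h_in j : h j \in S.
Proof. by have := codom_f h j; rewrite -hS inE => /andP[]. Qed.

Lemma sum_support (R : pzRingType) (F : edge G -> R) :
  {in Ep, forall e, e \notin S -> F e = 0} ->
  \sum_(e in Ep) F e = \sum_j F (h j).
Proof.
move=> FS; rewrite (bigID (mem S)) /= [X in _ + X]big1 ?addr0 => [|e /andP[]].
  rewrite (eq_bigl (fun e => e \in codom h)) => [|e]; last first.
    by rewrite -hS inE andbC.
  have ucod : uniq (codom h) by apply/injectiveP.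
  by rewrite -(big_uniq _ ucod) big_image.
exact: FS.
Qed.

Lemma coeff_bd_support c v : {in Ep, forall e, e \notin S -> ecoef e c = 0} ->
  coeff v (bd c) = \sum_j ecoef (h j) c * inc v (h j).
Proof.
move=> cS; rewrite (coeff_bd orE); apply: (sum_support (F := fun e => _ * _)).
by move=> e eE eS; rewrite cS // mul0r.
Qed.

Lemma chain_eq_support c d :
  {in Ep, forall e, e \notin S -> ecoef e c = 0} ->
  {in Ep, forall e, e \notin S -> ecoef e d = 0} ->
  (forall j, ecoef (h j) c = ecoef (h j) d) -> c = d.
Proof.
move=> cS dS cd; apply: (chain_eq orE) => e eE.
have [eS|eS] := boolP (e \in S); last by rewrite cS ?dS.
have /codomP[j ->] : e \in codom h by rewrite -hS inE eS.
exact: cd.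
Qed.

(** [Imx] selects the rows indexed by [g]; an edge [g i] outside [S] gives a zero row on both
    sides. *)
Lemma Imx_mul k q (g : 'I_k -> edge G) (c : 'I_q -> C1 G) :
  (forall i, g i \in Ep) ->
  (forall l, {in Ep, forall e, e \notin S -> ecoef e (c l) = 0}) ->
  Imx g h *m (\matrix_(j, l) ecoef (h j) (c l)) =
  \matrix_(i, l) ecoef (g i) (c l).
Proof.
move=> gE cS; apply/matrixP=> i l; rewrite !mxE.
have [gS|gS] := boolP (g i \in S).
  have /codomP[j gj] : g i \in codom h by rewrite -hS inE gS gE.
  rewrite (bigD1 j) //= !mxE gj eqxx mul1r big1 ?addr0 // => j' jj'.
  by rewrite !mxE gj (inj_eq h_inj) eq_sym (negPf jj') mul0r.
rewrite cS // big1 // => j _; rewrite !mxE.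
by case: eqP => [gj|_]; [rewrite gj h_in in gS|rewrite mul0r].
Qed.

(** The columns of [Q] are paths from the root, those of [C] are the cycle basis, and [Y] holds the
    coordinates in that basis of each edge closed by paths. An edge is its closed cycle plus paths,
    which gives the first product; the second one uses that [C] can be cancelled on the left. *)
Lemma Zbasis_inverse k (z : 'I_k -> C1 G) : connected S ->
  is_Zbasis (Z1 S) z ->
  exists Q : 'M[int]_(p, m), exists Y : 'M[int]_(k, p),
    let C := \matrix_(j, i) ecoef (h j) (z i) in
    [/\ row_mx Q C *m col_mx (Dmx h) Y = 1%:M,
        col_mx (Dmx h) Y *m row_mx Q C = 1%:M &
        Dmx h *m row_mx Q C = row_mx 1%:M 0].
Proof.
move=> cS [zZ zB]; have [q [qS qb]] := pathspec_ex sS cS.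
have zS l : {in Ep, forall e, e \notin S -> ecoef e (z l) = 0}.
  by have /(Z1P orE _ sS)[] := zZ l.
pose C := \matrix_(j < p, i < k) ecoef (h j) (z i).
pose Q := \matrix_(j < p, i < m) ecoef (h j) (q i).
have qS' i : {in Ep, forall e, e \notin S -> ecoef e (q i) = 0}.
  by move=> e _; apply: qS.
have DQ : Dmx h *m Q = 1%:M.
  apply/matrixP=> i i'; rewrite !mxE.
  transitivity (coeff (enum_val i) (bd (q i'))).
    rewrite (coeff_bd_support _ (qS' i')); apply: eq_bigr => j _.
    by rewrite !mxE mulrC.
  by rewrite qb [v0 == _]eq_sym enum_val_neq subr0 (inj_eq enum_val_inj) eq_sym.
have DC : Dmx h *m C = 0.
  apply/matrixP=> i i'; rewrite !mxE.
  have /(Z1P orE _ sS)[zS' zb] := zZ i'.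
  transitivity (coeff (enum_val i) (bd (z i'))).
    rewrite (coeff_bd_support _ zS'); apply: eq_bigr => j _.
    by rewrite !mxE mulrC.
  by rewrite zb coeff0.
have clZ j : Z1 S (close q (h j)).
  apply/(Z1P orE _ sS); split; last by apply: (@bd_close S).
  move=> e eE eS; rewrite ecoef_close (ecoef_ech_notin sS (h_in j) eS).
  by rewrite big1 ?subrr // => i _; rewrite qS // mulr0.
have ex j : exists a : {ffun 'I_k -> int}, close q (h j) = \sum_i a i *: z i.
  by have [a [aj _]] := zB _ (clZ j); exists a.
have [a aP] := choice ex.
pose Y := \matrix_(i < k, j < p) a j i.
have QDCY : Q *m Dmx h + C *m Y = 1%:M.
  apply/matrixP=> j j'; rewrite !mxE.
  have := congr1 (ecoef (h j)) (aP j').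
  rewrite ecoef_close (ecoef_ech_oriented orE) ?h_oriented // ecoef_sum.
  rewrite (inj_eq h_inj) eq_sym => /eqP; rewrite subr_eq => /eqP ->.
  rewrite addrC; congr (_ + _); apply: eq_bigr => i _; rewrite !mxE ?ecoefZ //.
    by rewrite mulrC.
  by rewrite mulrC.
(* The columns of [w] are coordinates of the zero cycle, which are unique in a basis. *)
have C_inj q' (w : 'M[int]_(k, q')) : C *m w = 0 -> w = 0.
  move=> Cw; apply/matrixP=> i l; rewrite mxE.
  have Z0 : Z1 S 0.
    by apply/(Z1P orE _ sS); split=> [e _ _|]; rewrite ?ecoef0 ?bd0.
  have [a0 [_ a0u]] := zB _ Z0.
  have e1 : a0 = [ffun=> 0].
    by apply: a0u; rewrite big1 // => l' _; rewrite ffunE scale0r.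
  have : a0 = [ffun i => w i l].
    apply: a0u; apply: chain_eq_support => [e _ _|e eE eS|j].
    - by rewrite ecoef0.
    - by rewrite ecoef_sum big1 // => l' _; rewrite ecoefZ zS // mulr0.
    rewrite ecoef0 ecoef_sum; have /matrixP/(_ j l) := Cw.
    rewrite !mxE => Cw0; rewrite -[LHS]Cw0.
    by apply: eq_bigr => l' _; rewrite mxE ecoefZ ffunE mulrC.
  by rewrite e1 => /ffunP/(_ i); rewrite !ffunE.
have CY : C *m Y = 1%:M - Q *m Dmx h by rewrite -QDCY addrC addKr.
have YC : Y *m C = 1%:M.
  apply/eqP; rewrite -subr_eq0; apply/eqP/C_inj.
  by rewrite mulmxBr mulmxA CY mulmxBl -mulmxA DC mulmx0 mul1mx mulmx1 subr0
    subrr.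
have YQ : Y *m Q = 0.
  by apply: C_inj; rewrite mulmxA CY mulmxBl -mulmxA DQ mul1mx mulmx1 subrr.
exists Q, Y; split.
- by rewrite mul_row_col.
- by rewrite mul_col_row DQ DC YQ YC -scalar_mx_block.
- by rewrite mul_mx_row DQ DC.
Qed.

End Support.

(** A matrix with a two-sided inverse is square; this is the Euler relation between edges, vertices
    and the first Betti number. *)
Lemma Zbasis_size S p (h : 'I_p -> edge G) k (z : 'I_k -> C1 G) :
  is_subgraph S -> connected S -> injective h -> S :&: Ep =i codom h ->
  is_Zbasis (Z1 S) z -> p = (m + k)%N.
Proof.
move=> sS cS hi hS /(Zbasis_inverse sS hi hS cS)[Q [Y []]].
move=> /mulmx1_min le1 /mulmx1_min le2 _.
by apply/eqP; rewrite eqn_leq le1 le2.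
Qed.

(** Multiplying on the right by the unimodular matrix of [Zbasis_inverse] makes [Nmx g h] block
    triangular, with an identity block and the minor of the cycle basis. Its determinant [eps] is
    chosen before [g], so it cancels in a product of two minors. *)
Lemma det_Nmx S k (h : 'I_(m + k) -> edge G) (z : 'I_k -> C1 G) :
  is_subgraph S -> connected S -> injective h -> S :&: Ep =i codom h ->
  is_Zbasis (Z1 S) z ->
  exists2 eps : int, eps * eps = 1 & forall g : 'I_k -> edge G,
    (forall i, g i \in Ep) ->
    \det (Nmx g h) * eps = \det (\matrix_(i, j) ecoef (g i) (z j)).
Proof.
move=> sS cS hi hS zB.
have [Q [Y [QY _ DQC]]] := Zbasis_inverse sS hi hS cS zB.
have zS l : {in Ep, forall e, e \notin S -> ecoef e (z l) = 0}.
  by have /(Z1P orE _ sS)[] := zB.1 l.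
set QC := row_mx Q _ in QY DQC.
exists (\det QC) => [|g gE].
  have /mulmx1_unit[] := QY; rewrite unitmxE => + _.
  by case/orP => /eqP->; rewrite ?mulrNN mulr1.
rewrite -det_mulmx NmxE mul_col_mx DQC.
rewrite mul_mx_row (Imx_mul hi hS gE zS).
by rewrite [col_mx _ _](_ : _ = block_mx 1%:M 0 (Imx g h *m Q)
    (\matrix_(i, l) ecoef (g i) (z l))) // det_lblock det1 mul1r.
Qed.

Definition hgraph p (h : 'I_p -> edge G) : {set edge G} :=
  [set e | (e \in codom h) || (einv e \in codom h)].

Lemma hgraph_subgraph p (h : 'I_p -> edge G) : is_subgraph (hgraph h).
Proof. by apply/forall_inP=> e; rewrite !inE einvK orbC. Qed.

Lemma hgraph_oriented p (h : 'I_p -> edge G) : (forall j, h j \in Ep) ->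
  hgraph h :&: Ep =i codom h.
Proof.
move=> hE e; rewrite !inE; apply/andP/idP => [[/orP[//|/codomP[j ej]] eE]|].
  by have := hE j; rewrite -ej (orientedN orE) eE.
by move=> he; rewrite he; split=> //; have /codomP[j ->] := he.
Qed.

Lemma hgraph_unique p (h : 'I_p -> edge G) S : is_subgraph S ->
  S :&: Ep =i codom h -> hgraph h = S.
Proof.
move=> sS hS; apply/setP=> e; rewrite inE -!hS !inE.
rewrite (orientedN orE) is_subgraph_einv //.
by rewrite -andb_orr orbN andbT.
Qed.

Lemma connected_sub S S' : S \subset S' -> connected S -> connected S'.
Proof.
move=> sub /andP[V0 /forallP cS]; rewrite /connected V0.
apply/forallP=> u; apply/forallP=> v; have /forallP/(_ v) := cS u.
apply: connect_sub => {u v}u v /exists_inP[e eS ev]; apply: connect1.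
by apply/exists_inP; exists e => //; apply: subsetP eS.
Qed.

(** A nonzero determinant forces the edges [h] to be distinct and to contain the distinct edges [g].
    Without [g] the graph stays connected, and the edges of [g], closed by paths in what remains,
    form a cycle basis. *)
Lemma det_Nmx_conn k (h : 'I_(m + k) -> edge G) (g : 'I_k -> edge G) :
  (forall j, h j \in Ep) -> (forall i, g i \in Ep) ->
  \det (Nmx g h) != 0 -> injective h /\ hgraph h \in conn_subgraphs G k.
Proof.
move=> hE gE dN.
have h_inj : injective h.
  move=> i j hij; apply/eqP; apply: contraNT dN => ij.
  apply/eqP; rewrite -det_tr; apply: (determinant_alternate ij) => l.
  by rewrite !mxE hij.
have g_inj : injective g.
  move=> i j gij; apply/eqP; apply: contraNT dN => ij; apply/eqP.
  have ij' : rshift m i != rshift m j by rewrite eq_rshift.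
  apply: (determinant_alternate ij') => l.
  by rewrite NmxE !col_mxEd !mxE gij.
have g_h i : g i \in codom h.
  apply: contraNT dN => gi; apply/eqP.
  rewrite (expand_det_row _ (rshift m i)) big1 // => j _.
  rewrite NmxE col_mxEd mxE; case: eqP => [gj|]; last by rewrite mul0r.
  by rewrite gj codom_f in gi.
split=> //; set S := hgraph h; have sS : is_subgraph S := hgraph_subgraph h.
have hS : S :&: Ep =i codom h := hgraph_oriented hE.
have g_S i : g i \in S by have := g_h i; rewrite -hS inE => /andP[].
pose T := [set e in S | (e \notin codom g) && (einv e \notin codom g)].
have sT : is_subgraph T.
  apply/forall_inP=> e; rewrite [e \in T]inE [_ \in T]inE einvK.
  by rewrite is_subgraph_einv // => /and3P[-> -> ->].
have hT j : (h j \in T) = (h j \notin codom g).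
  rewrite inE (h_in hS) /=; case: (_ \in codom g) => //=.
  apply/negP=> /codomP[i hi]; have := gE i.
  by rewrite -hi (orientedN orE) hE.
have cT : connected T.
  apply: (connected_cut (v0 := v0) sT) => U v0U cutU.
  (* If no edge of [T] crosses the boundary of [U], the indicator [u] of [U] combines the rows of
     [D] into [cut], which is supported on the edges of [g]. The coefficients [w] cancel it there,
     so [(u, w)] kills a nonsingular matrix. *)
  pose cut e : int := (tgt e \in U)%:R - (src e \in U)%:R.
  pose u : 'rV[int]_m := \row_i (enum_val i \in U)%:R.
  pose w : 'rV[int]_k := \row_i - cut (g i).
  have uD j : (u *m Dmx h) 0 j = cut (h j).
    rewrite mxE.
    transitivity (\sum_v (v \in U)%:R * inc v (h j)).
      rewrite sum_nroot (negPf v0U) mul0r add0r.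
      by apply: eq_bigr => i _; rewrite !mxE.
    have s1 x : \sum_v (v \in U)%:R * (x == v)%:R = (x \in U)%:R :> int.
      rewrite (bigD1 x) //= eqxx mulr1 big1 ?addr0 // => v.
      by rewrite eq_sym => /negPf ->; rewrite mulr0.
    rewrite /inc; under eq_bigr do rewrite mulrBr.
    by rewrite sumrB !s1.
  have : row_mx u w *m Nmx g h = 0.
    rewrite NmxE mul_row_col; apply/rowP=> j; rewrite mxE uD !mxE.
    have [/codomP[i hi]|hg] := boolP (h j \in codom g).
      rewrite (bigD1 i) //= !mxE hi eqxx mulr1 big1 ?addr0 ?subrr // => i' ii'.
      by rewrite !mxE hi (inj_eq g_inj) (negPf ii') mulr0.
    have -> : cut (h j) = 0 by rewrite /cut cutU ?hT // subrr.
    rewrite add0r big1 // => i _; rewrite !mxE.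
    by case: eqP => [gi|]; [rewrite -gi codom_f in hg|rewrite mulr0].
  move/(mulmx_det_eq0 dN)/(congr1 lsubmx).
  rewrite row_mxKl (linear0 lsubmx) => u0.
  apply/setP=> v; rewrite inE; have [->|vv0] := eqVneq v v0; first exact: negPf.
  have vin : v \in predC1 v0 by [].
  have /rowP/(_ (enum_rank_in vin v)) := u0.
  by rewrite !mxE enum_rankK_in //; case: (v \in U).
have TS : T \subset S by apply/subsetP=> e; rewrite inE => /andP[].
rewrite inE sS (connected_sub TS cT) /=; apply/asboolP.
have [q qP] := pathspec_ex sT cT.
(* The paths avoid the edges of [g], so the coordinates of the [z i] along [g] form the identity
   matrix, and coordinates in this basis are read off on [g]. *)
pose z i := close q (g i).
have zZ i : Z1 S (z i).
  apply/(Z1P orE _ sS); split; last exact: bd_close qP.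
  move=> e eE eS; rewrite ecoef_close (ecoef_ech_notin sS (g_S i) eS).
  rewrite big1 ?subrr // => l _; rewrite qP.1 ?mulr0 //.
  by apply: contraNN eS; apply: (subsetP TS).
have zg i l : ecoef (g l) (z i) = (i == l)%:R.
  rewrite ecoef_close (ecoef_ech_oriented orE) // (inj_eq g_inj).
  rewrite big1 ?subr0 // => l' _; rewrite qP.1 ?mulr0 //.
  by rewrite inE codom_f andbF.
exists z; split=> // c cZ; have [cS cb] := (Z1P orE c sS).1 cZ.
exists [ffun i => ecoef (g i) c]; split=> [|a ca]; last first.
  apply/ffunP=> i; rewrite ffunE ca ecoef_sum (bigD1 i) //= ecoefZ zg eqxx.
  rewrite mulr1.
  rewrite big1 ?addr0 // => l li; rewrite ecoefZ zg.
  by rewrite (negPf li) mulr0.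
(* The difference [d] is a cycle of [S] with zero coordinates along [g], so both blocks of [Nmx g h]
   kill its coordinate column. *)
apply/eqP; rewrite -subr_eq0; apply/eqP; set d := c - _.
have dS : {in Ep, forall e, e \notin S -> ecoef e d = 0}.
  move=> e eE eS; rewrite ecoefB cS // ecoef_sum big1 ?subrr // => i _.
  by have [zS _] := (Z1P orE _ sS).1 (zZ i); rewrite ecoefZ zS ?mulr0.
have db : bd d = 0.
  rewrite /d addrC -scaleN1r bd_linear cb bd_sum big1 ?scaler0 ?addr0 // => i _.
  by have [_ zb] := (Z1P orE _ sS).1 (zZ i); rewrite bdZ zb scaler0.
have dg i : ecoef (g i) d = 0.
  rewrite ecoefB ecoef_sum (bigD1 i) //= ecoefZ zg eqxx mulr1 ffunE.
  rewrite big1 ?addr0 ?subrr // => l li; rewrite ecoefZ zg.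
  by rewrite (negPf li) mulr0.
pose dv : 'cV[int]_(m + k) := \matrix_(j, l) ecoef (h j) d.
have : Nmx g h *m dv = 0.
  rewrite NmxE mul_col_mx (_ : Dmx h *m dv = 0); last first.
    apply/colP=> i; rewrite !mxE.
    transitivity (coeff (enum_val i) (bd d)); last by rewrite db coeff0.
    rewrite (coeff_bd_support h_inj hS _ dS); apply: eq_bigr => j _.
    by rewrite !mxE mulrC.
  rewrite (Imx_mul h_inj hS gE (c := fun=> d)) //.
  rewrite (_ : \matrix_(i, l) _ = 0) ?col_mx0 //.
  by apply/matrixP=> i l; rewrite !mxE dg.
move/(mulmx_det_eq0r dN) => dv0.
apply: (chain_eq_support hS dS) => [e _ _|j]; first exact: ecoef0.
by have /colP/(_ j) := dv0; rewrite !mxE ecoef0.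
Qed.

End Incidence.

(** * The weighted sum of minors *)

Lemma codom_inj_card (T : finType) (A : {set T}) p (h : {ffun 'I_p -> T}) :
  #|A| = p -> injective h -> (forall j, h j \in A) -> A =i codom h.
Proof.
move=> Ap hi hA.
have E : #|codom h| = #|A| by rewrite card_codom // card_ord.
suff hA' : codom h =i A by move=> e; rewrite hA'.
by apply/(subset_cardP E)/subsetP=> _ /codomP[j ->].
Qed.

(** A set of [p] elements has [p!] injective enumerations; this converts sums over maps back into
    sums over subsets. *)
Lemma sumr_inj_ffuns (T : finType) (V : nmodType) (A : {set T}) p
    (F : {ffun 'I_p -> T} -> V) (c : V) :
  #|A| = p ->
  (forall h : {ffun 'I_p -> T}, injective h -> A =i codom h -> F h = c) ->
  \sum_(h : {ffun 'I_p -> T} | injectiveb h && [forall j, h j \in A]) F h =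
  c *+ p`!.
Proof.
move=> Ap Fc.
rewrite (eq_bigr (fun=> c)) => [|h /andP[/injectiveP hi /forallP hA]].
  have := card_inj_ffuns_on 'I_p (mem A); rewrite card_ord Ap ffactnn => <-.
  rewrite sumr_const.
  congr (c *+ _); apply: eq_card => h; rewrite !inE andbC.
  by congr (_ && _); apply/forallP/ffun_onP.
by apply: Fc => //; apply: codom_inj_card.
Qed.

Lemma det_scale_cols (R : comPzRingType) n (A : 'I_n -> 'I_n -> R)
    (d : 'I_n -> R) :
  \det (\matrix_(i, j) (A i j * d j)) =
  \det (\matrix_(i, j) A i j) * \prod_j d j.
Proof.
have -> : \matrix_(i, j) (A i j * d j) =
    \matrix_(i, j) A i j *m diag_mx (\row_j d j).
  by apply/matrixP=> i j; rewrite mul_mx_diag !mxE.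
rewrite det_mulmx det_diag; congr (_ * _).
by apply: eq_bigr => j _; rewrite mxE.
Qed.

Lemma det_scale_rows (R : comPzRingType) n (A : 'I_n -> 'I_n -> R)
    (d : 'I_n -> R) :
  \det (\matrix_(i, j) (d i * A i j)) =
  (\prod_j d j) * \det (\matrix_(i, j) A i j).
Proof.
have -> : \matrix_(i, j) (d i * A i j) =
    diag_mx (\row_i d i) *m \matrix_(i, j) A i j.
  by apply/matrixP=> i j; rewrite mul_diag_mx !mxE.
rewrite det_mulmx det_diag; congr (_ * _).
by apply: eq_bigr => j _; rewrite mxE.
Qed.

(** Block elimination with pivot [A]. *)
Lemma det_schur (R : comUnitRingType) m n (A : 'M[R]_m) (B : 'M[R]_(m, n))
    (C : 'M[R]_(n, m)) (D : 'M[R]_n) : A \in unitmx ->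
  \det (block_mx A B C D) = \det A * \det (D - C *m invmx A *m B).
Proof.
move=> uA.
have -> : block_mx A B C D =
    block_mx A 0 C (D - C *m invmx A *m B) *m
    block_mx 1%:M (invmx A *m B) 0 1%:M.
  rewrite mulmx_block !mulmx1 !mul0mx !mulmx0 !addr0 mulmxA mulmxV // mul1mx.
  by rewrite mulmxA addrC subrK.
by rewrite det_mulmx det_lblock det_ublock !det1 !mulr1.
Qed.

Section Weights.
Variables (R : realType) (G : graph) (v0 : vertex G) (Ep : {set edge G}).
Variable (x : edge G -> R).
Hypotheses (orE : is_orientation Ep) (cG : connected [set: edge G]).
Hypothesis x_gt0 : forall e, 0 < x e.
Local Notation m := (nroot v0).
Local Notation dinc := (@dinc G v0).

(* Extending the weights by 0 lets sums range over all oriented edges. *)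
Definition wt e : R := if e \in Ep then x e else 0.

(** The product of [Nmx] for [g], the diagonal matrix of the weights, and the transpose of [Nmx] for
    [f], taken over all edges. *)
Definition Gram k (g f : 'I_k -> edge G) : 'M[R]_(m + k) :=
  \matrix_(i, j) \sum_e ((nrow g i e)%:~R * wt e) * (nrow f j e)%:~R.

(** The minor [det(Z^K_I)] of the cycle basis, on the edges listed by [g]. *)
Definition dZ k (z : 'I_k -> C1 G) (g : 'I_k -> edge G) : int :=
  \det (\matrix_(i, j) ecoef (g i) (z j)).

Lemma weight_codom S p (h : 'I_p -> edge G) : is_subgraph S ->
  injective h -> S :&: Ep =i codom h -> \prod_j wt (h j) = weight Ep x S.
Proof.
move=> sS hi hS.
have -> : weight Ep x S = \prod_(e in codom h) wt e.
  apply: eq_big => [e|e]; last by rewrite inE => /andP[_ eE]; rewrite /wt eE.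
  rewrite -hS !inE; congr (_ && _).
  have -> : (e \in einv @: S) = (e \in S); last by rewrite orbb.
  rewrite -[e in LHS]einvK mem_imset; last exact: can_inj (@einvK G).
  exact: is_subgraph_einv.
have ucod : uniq (codom h) by apply/injectiveP.
by rewrite -(big_uniq _ ucod) big_image.
Qed.

(** Cauchy-Binet expands the right side over maps [h]. The surviving ones enumerate the oriented
    edges of a connected subgraph of Betti number [k]; grouped by subgraph, they give [p!] equal
    terms each. *)
Lemma conn_sum k (z : {set edge G} -> 'I_k -> C1 G) (g f : 'I_k -> edge G) :
  (forall S, S \in conn_subgraphs G k -> is_Zbasis (Z1 S) (z S)) ->
  (forall i, g i \in Ep) -> (forall i, f i \in Ep) ->
  \sum_(S in conn_subgraphs G k) weight Ep x S * (dZ (z S) g * dZ (z S) f)%:~R =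
  \det (Gram g f).
Proof.
move=> zB gE fE; set p := (m + k)%N.
apply: (pmulrnI (fact_gt0 p)) => /=.
rewrite [RHS](cauchy_binet (fun i e => (nrow g i e)%:~R * wt e)
  (fun i e => (nrow f i e)%:~R)).
pose Psi (h : {ffun 'I_p -> edge G}) : R :=
  (\prod_j wt (h j)) * (\det (Nmx v0 g h) * \det (Nmx v0 f h))%:~R.
have detN (f' : 'I_k -> edge G) (h : {ffun 'I_p -> edge G}) :
    \det (\matrix_(i, j) (nrow f' i (h j))%:~R) = (\det (Nmx v0 f' h))%:~R :> R.
  by rewrite -det_map_mx; congr (\det _); apply/matrixP=> i j; rewrite !mxE.
rewrite [RHS](eq_bigr Psi) => [|h _]; last first.
  rewrite (det_scale_cols (fun i j => (nrow g i (h j))%:~R)) !detN /Psi.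
  by rewrite rmorphM /= mulrA; congr (_ * _); exact: mulrC.
pose P (h : {ffun 'I_p -> edge G}) :=
  [&& injectiveb h, [forall j, h j \in Ep] & hgraph h \in conn_subgraphs G k].
(* A nonzero term has all its edges in [Ep] and a nonzero determinant, so [det_Nmx_conn] applies. *)
have PsiN h : ~~ P h -> Psi h = 0.
  apply: contraNeq; rewrite /Psi mulf_eq0 negb_or rmorphM mulf_eq0 negb_or.
  case/andP=> wh /andP[dg _]; have hE j : h j \in Ep.
    by apply: contraNT wh => hj; rewrite prodf_seq_eq0; apply/hasP; exists j;
       rewrite ?mem_index_enum // /wt (negPf hj) eqxx.
  have [] := det_Nmx_conn orE hE gE (v0 := v0).
    by apply: contraNneq dg => ->.
  by move=> /injectiveP hi hC; apply/and3P; split=> //; apply/forallP.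
rewrite [RHS](bigID P) /= [X in _ = _ + X]big1 ?addr0; last exact: PsiN.
rewrite (partition_big (fun h : {ffun 'I_p -> edge G} => hgraph h)
   (mem (conn_subgraphs G k))) /=; last by move=> h /and3P[].
rewrite -sumrMnl; apply: eq_bigr => S SC.
have zS := zB S SC; move: (SC); rewrite inE => /and3P[sS cS _].
have Sp : #|S :&: Ep| = p.
  apply: (Zbasis_size v0 orE sS cS (h := fun i => enum_val i) _ _ zS).
    exact: enum_val_inj.
  by move=> e; apply/idP/codomP => [eS|[i ->]];
    [exists (enum_rank_in eS e); rewrite enum_rankK_in|exact: enum_valP].
rewrite [RHS](eq_bigl (fun h : {ffun 'I_p -> edge G} =>
    injectiveb h && [forall j, h j \in S :&: Ep])).
  apply/esym/sumr_inj_ffuns => // h hi hS.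
  rewrite /Psi (weight_codom sS hi hS); congr (_ * _%:~R).
  (* The same sign occurs in both minors and squares to 1. *)
  have [eps eps2 detE] := det_Nmx (v0 := v0) orE sS cS hi hS zS.
  rewrite /dZ -!detE // mulrACA eps2 mulr1 //.
move=> h; apply/andP/andP => [[/and3P[hi /forallP hE hC] /eqP hS]|].
  split=> //; apply/forallP=> j; rewrite -hS (hgraph_oriented orE hE).
  exact: codom_f.
case=> hi /forallP hS.
have hS' := codom_inj_card Sp (elimT (injectiveP _) hi) hS.
have -> := hgraph_unique orE sS hS'; split=> //; apply/and3P; split=> //.
  by apply/forallP=> j; have := hS j; rewrite inE => /andP[].
by rewrite (hgraph_unique orE sS hS').
Qed.

Definition Lap : 'M[R]_m :=
  \matrix_(i, j) \sum_e ((dinc i e)%:~R * wt e) * (dinc j e)%:~R.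

(** If [u L = 0], then [u L u^T] is zero; it is the weighted sum of the squares of the entries of
    [u D], so [u D] vanishes on [Ep]. Pairing [u] with the boundary of a path from the root to the
    vertex [i] then gives [u_i = 0]. *)
Lemma Lap_unit : Lap \in unitmx.
Proof.
rewrite -row_free_unit; apply: inj_row_free => u uL.
pose w e : R := \sum_i u 0 i * (dinc i e)%:~R.
have uLE j : (u *m Lap) 0 j = \sum_e (w e * wt e) * (dinc j e)%:~R.
  rewrite mxE; under eq_bigr do rewrite mxE mulr_sumr.
  rewrite exchange_big; apply: eq_bigr => e _ /=.
  by rewrite /w !mulr_suml; apply: eq_bigr => i _; rewrite !mulrA.
have w0 e : e \in Ep -> w e = 0.
  have : \sum_e wt e * w e ^+ 2 = 0.
    transitivity (\sum_j (u *m Lap) 0 j * u 0 j); last first.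
      by rewrite big1 // => j _; rewrite uL mxE mul0r.
    under [RHS]eq_bigr do rewrite uLE mulr_suml.
    rewrite exchange_big; apply: eq_bigr => f _ /=.
    transitivity (w f * wt f * w f); first by ring.
    rewrite {2}/w mulr_sumr; apply: eq_bigr => j _.
    by rewrite -[RHS]mulrA; congr (_ * _); exact: mulrC.
  move=> /eqP; rewrite psumr_eq0 => [/allP w0 eE|f _].
    have := w0 e (mem_index_enum e); rewrite /wt eE /= mulf_eq0 gt_eqF //=.
    by rewrite sqrf_eq0 => /eqP.
  by rewrite /wt; case: ifP => _; rewrite ?mul0r // mulr_ge0 ?sqr_ge0 ?ltW.
have sG : is_subgraph [set: edge G] by apply/forall_inP=> e; rewrite !inE.
have [q [_ qb]] := pathspec_ex v0 sG cG.
apply/rowP=> i; rewrite mxE.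
transitivity (\sum_l u 0 l * (coeff (enum_val l) (bd (q i)))%:~R).
  rewrite (bigD1 i) //= qb eqxx [v0 == _]eq_sym enum_val_neq subr0 mulr1.
  rewrite big1 ?addr0 // => l li; rewrite qb [v0 == _]eq_sym enum_val_neq subr0.
  by rewrite (inj_eq enum_val_inj) eq_sym (negPf li) mulr0.
under eq_bigr do rewrite (coeff_bd orE) rmorph_sum mulr_sumr /=.
rewrite exchange_big big1 //= => e eE.
transitivity ((ecoef e (q i))%:~R * w e); last by rewrite w0 ?mulr0.
by rewrite mulr_sumr; apply: eq_bigr => l _; rewrite rmorphM /= mulrCA.
Qed.

(* The entries of [1 - D^T L^-1 D X]. *)
Definition Pmat e' e : R :=
  (e' == e)%:R -
  (\sum_a \sum_b (dinc a e')%:~R * invmx Lap a b * (dinc b e)%:~R) * wt e.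

(** In matrix form, [D X P = D X - L L^-1 D X = 0]: the columns of [P] represent elements of the
    kernel of the adjoint. *)
Lemma Pmat_cut i e : e \in Ep ->
  \sum_(e' in Ep) x e' * (dinc i e')%:~R * Pmat e' e = 0.
Proof.
move=> eE.
transitivity (\sum_e' (dinc i e')%:~R * wt e' * Pmat e' e).
  rewrite big_mkcond; apply: eq_bigr => e' _; rewrite /wt; case: ifP => _.
    by rewrite [x e' * _]mulrC.
  by rewrite mulr0 mul0r.
under eq_bigr do rewrite mulrBr.
rewrite sumrB (bigD1 e) //= eqxx mulr1 big1 => [|e' /negPf ->]; last first.
  by rewrite mulr0.
rewrite addr0.
apply/eqP; rewrite subr_eq0 eq_sym; apply/eqP.
transitivity (\sum_b (Lap *m invmx Lap) i b * (dinc b e)%:~R * wt e).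
  under [RHS]eq_bigr do rewrite mxE -mulrA mulr_suml.
  rewrite [RHS]exchange_big /=.
  under [RHS]eq_bigr => a _ do under eq_bigr do rewrite mxE !mulr_suml.
  under [RHS]eq_bigr do rewrite exchange_big /=.
  rewrite [RHS]exchange_big /=; apply: eq_bigr => e' _.
  rewrite mulrA mulr_sumr mulr_suml; apply: eq_bigr => a _.
  rewrite mulr_sumr mulr_suml; apply: eq_bigr => b _.
  by rewrite !mulrA.
rewrite mulmxV ?Lap_unit // (bigD1 i) //= mxE eqxx mul1r big1 ?addr0 // => b.
by rewrite mxE eq_sym => /negPf ->; rewrite !mul0r.
Qed.

(** The Schur complement of [Lap] in [Gram g f] is [X_I P_IJ], where [X_I] scales the rows by the
    weights of [g]. *)
Lemma det_Gram k (g f : 'I_k -> edge G) :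
  (forall i, g i \in Ep) -> (forall i, f i \in Ep) ->
  \det (Gram g f) =
  \det Lap * ((\prod_i x (g i)) * \det (\matrix_(i, j) Pmat (g i) (f j))).
Proof.
move=> gE fE.
pose B : 'M[R]_(m, k) := \matrix_(i, j) ((dinc i (f j))%:~R * x (f j)).
pose C : 'M[R]_(k, m) := \matrix_(i, j) (x (g i) * (dinc j (g i))%:~R).
pose D : 'M[R]_k := \matrix_(i, j) (x (g i) * (g i == f j)%:R).
have pick (e : edge G) (F : edge G -> R) : \sum_e' F e' * (e == e')%:R = F e.
  rewrite (bigD1 e) //= eqxx mulr1 big1 ?addr0 // => e'.
  by rewrite eq_sym => /negPf ->; rewrite mulr0.
have wtE e : e \in Ep -> wt e = x e by rewrite /wt => ->.
have -> : Gram g f = block_mx Lap B C D.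
  rewrite -[LHS]submxK; congr block_mx; apply/matrixP=> i j; rewrite !mxE.
  - by apply: eq_bigr => e _; rewrite !nrowl.
  - under eq_bigr do rewrite nrowl nrowr rmorph_nat.
    by rewrite pick wtE.
  - under eq_bigr do rewrite nrowl nrowr rmorph_nat -mulrA mulrC.
    by rewrite pick wtE.
  under eq_bigr do rewrite !nrowr !rmorph_nat -mulrA mulrC.
  by rewrite pick wtE // eq_sym.
rewrite (det_schur _ _ _ Lap_unit) -det_scale_rows; congr (_ * \det _).
apply/matrixP=> i j; rewrite !mxE /Pmat mulrBr; congr (_ - _).
rewrite (wtE _ (fE j)) exchange_big /= mulr_suml mulr_sumr.
apply: eq_bigr => b _; rewrite !mxE !mulr_suml mulr_sumr.
by apply: eq_bigr => a _; rewrite !mxE !mulrA.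
Qed.

(** The matrix-tree theorem, as the case [k = 0] of [conn_sum], where all the minors of cycle bases
    are empty and equal to 1. *)
Lemma tree_sum : \sum_(T in spanning_trees G) weight Ep x T = \det Lap.
Proof.
rewrite (spanning_trees_betti0 orE).
have g0 : 'I_0 -> edge G by case.
have gE i : g0 i \in Ep by case: i.
have ex S : exists z : 'I_0 -> C1 G,
    S \in conn_subgraphs G 0 -> is_Zbasis (Z1 S) z.
  have [|_] := boolP (S \in conn_subgraphs G 0).
    by rewrite inE => /and3P[_ _ /asboolP[z zB]]; exists z.
  by exists (fun=> 0).
have [z zP] := choice ex.
have := conn_sum zP gE gE; rewrite det_Gram // det_mx00 big_ord0 !mulr1 => <-.
by apply: eq_bigr => S _; rewrite /dZ !det_mx00 mulr1.
Qed.

Lemma conn_tree_sum k (z : {set edge G} -> 'I_k -> C1 G)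
    (g f : 'I_k -> edge G) :
  (forall S, S \in conn_subgraphs G k -> is_Zbasis (Z1 S) (z S)) ->
  (forall i, g i \in Ep) -> (forall i, f i \in Ep) ->
  \sum_(S in conn_subgraphs G k) weight Ep x S * (dZ (z S) g * dZ (z S) f)%:~R =
  (\sum_(T in spanning_trees G) weight Ep x T) *
  ((\prod_i x (g i)) * \det (\matrix_(i, j) Pmat (g i) (f j))).
Proof. by move=> zB gE fE; rewrite conn_sum // det_Gram // tree_sum. Qed.

End Weights.

(** * The projection on the kernel of the adjoint *)

Section Scalars.
Variables (R : realType) (F : scalars).
Local Notation K := (fieldK R F).
Local Notation iota := (ofR R F).
Local Notation conj := (conjK R F).

Lemma conjK_ofR r : conj (iota r) = iota r.
Proof. by case: F => //=; rewrite /real_complex_def /= oppr0. Qed.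

Lemma conjKK : involutive conj.
Proof. by case: F => [//|[a b]] /=; rewrite opprK. Qed.

(** The squared modulus with real values, which lets positivity be argued for both fields at
    once. *)
Lemma conjK_norm : exists N : K -> R, forall z,
  [/\ conj z * z = iota (N z), 0 <= N z & N z = 0 -> z = 0].
Proof.
case: F => /=.
  exists (fun z => z ^+ 2) => z; split=> //; first exact: sqr_ge0.
  by move/eqP; rewrite sqrf_eq0 => /eqP.
exists (fun z => complex.Re z ^+ 2 + complex.Im z ^+ 2) => -[a b] /=; split.
- apply/eqP; rewrite eq_complex /= mulNr opprK -!expr2 eqxx /=.
  by rewrite mulNr [b * a]mulrC subrr.
- by rewrite addr_ge0 ?sqr_ge0.
move/eqP; rewrite paddr_eq0 ?sqr_ge0 // !sqrf_eq0 => ab0.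
by apply/eqP; rewrite eq_complex.
Qed.

Lemma sum_conj_eq0 (I : finType) (A : {set I}) (x : I -> R) (z : I -> K) :
  (forall i, 0 < x i) ->
  \sum_(i in A) iota (x i) * conj (z i) * z i = 0 -> {in A, forall i, z i = 0}.
Proof.
move=> x_gt0; have [N NP] := conjK_norm.
have E i : iota (x i) * conj (z i) * z i = iota (x i * N (z i)).
  by have [Nz _ _] := NP (z i); rewrite -mulrA Nz rmorphM.
rewrite (eq_bigr _ (fun i _ => E i)) -rmorph_sum => /eqP; rewrite fmorph_eq0.
rewrite psumr_eq0 => [/allP z0 i iA|i _]; last first.
  by have [_ N0 _] := NP (z i); rewrite mulr_ge0 // ltW.
have := z0 i (mem_index_enum i); rewrite iA /= mulf_eq0 gt_eqF //= => /eqP.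
by have [_ _] := NP (z i).
Qed.

End Scalars.

#[local] Arguments hom_fun : simpl never.

Section Forms.
Variables (G : graph) (R : realType) (F : scalars).
Variables (Ep : {set edge G}) (x : edge G -> R).
Hypotheses (orE : is_orientation Ep) (x_gt0 : forall e, 0 < x e).
Local Notation K := (fieldK R F).
Local Notation iota := (ofR R F).
Local Notation conj := (conjK R F).
Local Notation Omega1 := (Omega1 G R F).
Implicit Types (a b c : Omega1) (e f : edge G).

Lemma homD (a : Omega1) (c d : C1 G) : a (c + d) = a c + a d.
Proof. by case: a => a h; have /asboolP := h. Qed.

Lemma hom0 (a : Omega1) : a 0 = 0.
Proof. by apply: (addrI (a 0)); rewrite -homD !addr0. Qed.

Lemma homZ (a : Omega1) (n : int) (c : C1 G) : a (n *: c) = n%:~R * a c.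
Proof.
have homN d : a (- d) = - a d.
  by apply/eqP; rewrite -addr_eq0 -homD addNr hom0.
have homMn d p : a (d *+ p) = p%:R * a d.
  elim: p => [|p IHp]; first by rewrite mulr0n hom0 mul0r.
  by rewrite !mulrS homD IHp mulrDl mul1r.
rewrite -{1}[n]intz scaler_int; case: n => p.
  by rewrite -pmulrn homMn.
by rewrite NegzE mulrNz homN -pmulrn homMn -mulNr mulrNz.
Qed.

Lemma hom_sum (a : Omega1) (I : Type) (r : seq I) (P : pred I) (f : I -> C1 G) :
  a (\sum_(i <- r | P i) f i) = \sum_(i <- r | P i) a (f i).
Proof. exact: (big_morph a (homD a) (hom0 a)). Qed.

Lemma hom_chainE (a : Omega1) (c : C1 G) :
  a c = \sum_(e in Ep) (ecoef e c)%:~R * a (ech e).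
Proof.
by rewrite {1}(chainE orE c) hom_sum; apply: eq_bigr => e _; rewrite homZ.
Qed.

Lemma hom_eq (a b : Omega1) : {in Ep, forall e, a (ech e) = b (ech e)} -> a = b.
Proof.
move=> ab; apply/val_inj/funext => c /=; rewrite !hom_chainE.
by apply: eq_bigr => e eE; rewrite ab.
Qed.

Lemma hom_linE (t : K) (a b : Omega1) (c : C1 G) :
  (t *: a + b) c = t * a c + b c.
Proof. by []. Qed.

Lemma hom_subE (a b : Omega1) (c : C1 G) : (a - b) c = a c - b c.
Proof. by []. Qed.

Lemma hom_combE (I : Type) (r : seq I) (P : pred I) (t : I -> K)
    (b : I -> Omega1) (c : C1 G) :
  (\sum_(i <- r | P i) t i *: b i) c = \sum_(i <- r | P i) t i * b i c.
Proof.
apply: (big_morph (fun a : Omega1 => a c)) => //.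
Qed.

Lemma estar_ech e f : e \in Ep -> f \in Ep ->
  estar R F e (ech f) = (f == e)%:R.
Proof.
move=> eE fE; rewrite cochain_ech.
have -> : (f == einv e) = false; last by rewrite subr0.
by apply: contraTF fE => /eqP->; rewrite (orientedN orE) negbK.
Qed.

Lemma estar_comb (t : edge G -> K) e : e \in Ep ->
  (\sum_(f in Ep) t f *: estar R F f) (ech e) = t e.
Proof.
move=> eE; rewrite hom_combE (bigD1 e eE) estar_ech // eqxx mulr1.
rewrite big1 => [|f /andP[fE fe]]; first exact: addr0.
by rewrite estar_ech // eq_sym (negPf fe) mulr0.
Qed.

Local Notation d0 := (@dOmega G R F).
Local Notation inner := (inner1 Ep x).

Lemma dOmega_ech g e : d0 g (ech e) = g (tgt e) - g (src e).
Proof. exact: cochain_ech. Qed.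

Lemma sum_incK (g : vertex G -> K) e :
  \sum_v g v * (inc v e)%:~R = g (tgt e) - g (src e).
Proof.
have s1 w : \sum_v g v * (w == v)%:R = g w.
  rewrite (bigD1 w) //= eqxx mulr1 big1 ?addr0 // => v.
  by rewrite eq_sym => /negPf ->; rewrite mulr0.
under eq_bigr do rewrite rmorphB /= !rmorph_nat mulrBr.
by rewrite sumrB !s1.
Qed.

Lemma innerB c (a b : Omega1) : inner c (a - b) = inner c a - inner c b.
Proof. by rewrite -sumrB; apply: eq_bigr => e _; rewrite hom_subE mulrBr. Qed.

Lemma inner_conj (a b : Omega1) : conj (inner a b) = inner b a.
Proof.
rewrite rmorph_sum; apply: eq_bigr => e _.
by rewrite !rmorphM /= conjKK conjK_ofR mulrAC.
Qed.

Lemma inner_eq0 (a : Omega1) : inner a a = 0 -> a = 0.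
Proof.
move=> /(sum_conj_eq0 (z := fun e => a (ech e)) x_gt0) a0.
by apply: hom_eq => e eE; rewrite a0.
Qed.

Lemma inner0_eq0 (f : Omega0 G R F) : (forall g, inner0 g f = 0) -> f = 0.
Proof.
move=> f0; apply/ffunP=> v; rewrite ffunE.
have := f0 [ffun u => (u == v)%:R]; rewrite /inner0 (bigD1 v) //= ffunE eqxx.
rewrite rmorph1 mul1r big1 ?addr0 // => u uv.
by rewrite ffunE (negPf uv) rmorph0 mul0r.
Qed.

Lemma dstar_eq0 (a : Omega1) :
  dstar Ep x a = 0 <-> forall g, inner (d0 g) a = 0.
Proof.
split=> [|a0]; last first.
  rewrite /dstar; case: xgetP => [f _ fP|//].
  by apply: inner0_eq0 => g; rewrite -fP a0.
pose f : Omega0 G R F :=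
  [ffun v => \sum_(e in Ep) iota (x e) * (inc v e)%:~R * a (ech e)].
have fP g : inner (d0 g) a = inner0 g f.
  rewrite /inner0; under [RHS]eq_bigr do rewrite ffunE mulr_sumr.
  rewrite exchange_big; apply: eq_bigr => e _ /=.
  rewrite dOmega_ech rmorphB /= -(sum_incK (fun v => conj (g v))).
  rewrite mulr_sumr mulr_suml; apply: eq_bigr => v _.
  by rewrite !mulrA; congr (_ * _ * _); exact: mulrC.
rewrite /dstar; case: xgetP => [h _ hP h0 g|/(_ f)[]//].
rewrite hP h0 /inner0 big1 // => v _.
by rewrite ffunE mulr0.
Qed.

Variable v0 : vertex G.
Hypothesis cG : connected [set: edge G].
Local Notation dinc := (@dinc G v0).
Local Notation P := (Pmat v0 Ep x).

Lemma Pi_ker_dstarE (a : Omega1) : Pi_ker_dstar F Ep x a =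
  \sum_(e' in Ep) (\sum_(e in Ep) iota (P e' e) * a (ech e)) *: estar R F e'.
Proof.
set b := RHS.
have bE e' : e' \in Ep -> b (ech e') = \sum_(e in Ep) iota (P e' e) * a (ech e).
  exact: estar_comb.
have bN : dstar Ep x b = 0.
  apply/dstar_eq0 => g.
  (* Subtracting the constant [g v0] leaves the differential unchanged and removes the term of the
     root. *)
  have gE e : d0 g (ech e) = \sum_i (g (enum_val i) - g v0) * (dinc i e)%:~R.
    have := sum_incK (fun v => g v - g v0) e.
    rewrite (sum_nroot v0) subrr mul0r add0r => ->.
    by rewrite opprB addrA subrK dOmega_ech.
  rewrite /inner1.
  under eq_bigr => e' e'E do rewrite gE rmorph_sum bE // mulr_sumr.
  under eq_bigr => e' e'E do under eq_bigr => e eE do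
    rewrite mulr_sumr mulr_suml.
  rewrite exchange_big big1 //= => e eE; rewrite exchange_big big1 //= => i _.
  transitivity (conj (g (enum_val i) - g v0) * a (ech e) *
     iota (\sum_(e' in Ep) x e' * (dinc i e')%:~R * P e' e)).
    rewrite rmorph_sum mulr_sumr; apply: eq_bigr => e' _.
    rewrite !rmorphM /= !rmorph_int.
    set X1 := iota (x e'); set X2 := iota (P e' e).
    set X3 := conj _; set X4 := _%:~R; set X5 := a _.
    ring.
  by rewrite Pmat_cut // rmorph0 mulr0.
have [g ag] : exists g, a - b = d0 g.
  (* The potential of [a - b] is [L^-1 D X a], extended by 0 at the root. *)
  pose mu i : K := \sum_(e in Ep) iota (\sum_j invmx (Lap v0 Ep x) i j *
    (dinc j e)%:~R * x e) * a (ech e).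
  exists [ffun v => \sum_i mu i * (enum_val i == v)%:R].
  apply: hom_eq => e' e'E; rewrite hom_subE bE // dOmega_ech !ffunE -sumrB.
  transitivity (\sum_i mu i * (dinc i e')%:~R); last first.
    apply: eq_bigr => i _; rewrite -mulrBr rmorphB /= !rmorph_nat.
    by rewrite [tgt e' == _]eq_sym [src e' == _]eq_sym.
  have {1}-> : a (ech e') = \sum_(e in Ep) (e' == e)%:R * a (ech e).
    rewrite (bigD1 e') //= eqxx mul1r big1 ?addr0 // => e /andP[_].
    by rewrite eq_sym => /negPf ->; rewrite mul0r.
  rewrite -sumrB; under [RHS]eq_bigr do rewrite mulr_suml.
  rewrite [RHS]exchange_big /=; apply: eq_bigr => e eE.
  rewrite -mulrBl; under [RHS]eq_bigr do rewrite mulrAC.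
  rewrite -mulr_suml; congr (_ * _).
  transitivity (iota (\sum_i (\sum_j invmx (Lap v0 Ep x) i j *
    (dinc j e)%:~R * x e) * (dinc i e')%:~R)); last first.
    by rewrite rmorph_sum; apply: eq_bigr => i _; rewrite rmorphM rmorph_int.
  rewrite -(rmorph_nat iota) -rmorphB /Pmat; congr (iota _).
  rewrite opprB addrC subrK /wt eE mulr_suml; apply: eq_bigr => i _.
  rewrite !mulr_suml; apply: eq_bigr => j _.
  ring.
have ab c : dstar Ep x c = 0 -> inner c (a - b) = 0.
  by move/dstar_eq0 => cN; rewrite ag -[LHS]conjKK inner_conj cN rmorph0.
rewrite /Pi_ker_dstar /orth_proj.
(* The existence of [b] rules out the default value. The chosen [b'] differs from [b] by an element
   of the kernel that is orthogonal to the kernel, hence to itself. *)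
case: xgetP => [b' _ [b'N b'P]|/(_ b)[]//].
have bb'N : dstar Ep x (b' - b) = 0.
  apply/dstar_eq0 => g'; rewrite innerB.
  by rewrite (dstar_eq0 b').1 // (dstar_eq0 b).1 // subrr.
apply/eqP; rewrite -subr_eq0; apply/eqP/inner_eq0.
rewrite {2}(_ : b' - b = (a - b) - (a - b')); last first.
  by rewrite opprB [RHS]addrC addrA subrK.
by rewrite innerB ab // b'P // subrr.
Qed.

End Forms.

(** * Exterior powers and tensor squares *)

Lemma pres_pi_eq0 (K : nzRingType) (X : choiceType)
    (rel : {freeg X / K} -> Prop) r :
  rel r -> pres_pi rel r = 0.
Proof.
move=> /relspan_rel; rewrite -[X in X \in _]subr0 -pres_pi_eq => /eqP ->.
exact: (raddf0 (\pi_(Quotient.quot (relspan rel)))).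
Qed.

Lemma pres_piB (K : nzRingType) (X : choiceType)
    (rel : {freeg X / K} -> Prop) f g :
  pres_pi rel (f - g) = pres_pi rel f - pres_pi rel g.
Proof. exact: (raddfB (\pi_(Quotient.quot (relspan rel)))). Qed.

Section Exterior.
Variables (K : comNzRingType) (V : lmodType K) (k : nat).

Lemma wedge_multilinear : multilinear (@wedge K V k).
Proof.
move=> v i a u w; apply/eqP; rewrite -subr_eq0 opprD addrA.
rewrite /wedge /pgen -pres_piZ -!pres_piB; apply/eqP/pres_pi_eq0.
by left; exists v, i, a, u, w.
Qed.

Lemma wedge_alternating : alternating (@wedge K V k).
Proof.
move=> v i j ij vij; apply: pres_pi_eq0; right.
by exists v, i, j.
Qed.

Lemma wedge_perm (J : Type) (b : J -> V) (f : {ffun 'I_k -> J}) (s : 'S_k) :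
  wedge [ffun i => b ([ffun i => f (s i)] i)] =
  (-1) ^+ s *: wedge [ffun i => b (f i)].
Proof.
rewrite -(alternating_perm _ _ wedge_multilinear wedge_alternating).
by congr wedge; apply/ffunP=> i; rewrite !ffunE.
Qed.

End Exterior.

Lemma extmapZ (K L : nzRingType) (sigma : {rmorphism K -> L}) (V : lmodType K)
    (W : lmodType L) (a : V -> W) k c (p : ext V k) :
  (forall c u w, a (c *: u + w) = sigma c *: a u + a w) ->
  extmap sigma a (c *: p) = sigma c *: extmap sigma a p.
Proof.
move=> al; have a0 : extmap sigma a (0 : ext V k) = 0.
  have := extmap_semilin al (-1) (0 : ext V k) 0.
  by rewrite scaler0 addr0 rmorphN1 scaleN1r addNr.
by rewrite -[c *: p]addr0 (extmap_semilin al) a0 addr0.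
Qed.

Lemma extmap_wedge_comp (K L : nzRingType) (sigma : {rmorphism K -> L})
    (V : lmodType K) (W : lmodType L) (a : V -> W) k (J : Type) (b : J -> V)
    (f : 'I_k -> J) :
  (forall c u w, a (c *: u + w) = sigma c *: a u + a w) ->
  extmap sigma a (wedge [ffun i => b (f i)]) = wedge [ffun i => a (b (f i))].
Proof.
move=> al; rewrite (extmap_wedge al).
by congr wedge; apply/ffunP=> i; rewrite !ffunE.
Qed.

Section Tensor.
Variables (R : comNzRingType) (K : nzRingType) (iota : {rmorphism R -> K}).
Variables (A B : lmodType K).
Local Notation tens := (@tens R K iota A B).

Lemma tens_linearl (c : R) a a' b :
  tens (iota c *: a + a') b = c *: tens a b + tens a' b.
Proof.
apply/eqP; rewrite -subr_eq0 opprD addrA.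
rewrite /tens /pgen -pres_piZ -!pres_piB; apply/eqP/pres_pi_eq0.
by left; exists c, a, a', b.
Qed.

Lemma tens_linearr (c : R) a b b' :
  tens a (iota c *: b + b') = c *: tens a b + tens a b'.
Proof.
apply/eqP; rewrite -subr_eq0 opprD addrA.
rewrite /tens /pgen -pres_piZ -!pres_piB; apply/eqP/pres_pi_eq0.
by right; exists c, a, b, b'.
Qed.

Lemma tens0l b : tens 0 b = 0.
Proof.
have := tens_linearl (-1) 0 0 b.
by rewrite scaler0 addr0 scaleN1r addNr.
Qed.

Lemma tens0r a : tens a 0 = 0.
Proof.
have := tens_linearr (-1) a 0 0.
by rewrite scaler0 addr0 scaleN1r addNr.
Qed.

Lemma tensZl c a b : tens (iota c *: a) b = c *: tens a b.
Proof. by rewrite -[iota c *: a]addr0 tens_linearl tens0l addr0. Qed.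

Lemma tensZr c a b : tens a (iota c *: b) = c *: tens a b.
Proof. by rewrite -[iota c *: b]addr0 tens_linearr tens0r addr0. Qed.

Lemma tensDl a a' b : tens (a + a') b = tens a b + tens a' b.
Proof.
by rewrite -[a]scale1r -(rmorph1 iota) tens_linearl rmorph1 !scale1r.
Qed.

Lemma tensDr a b b' : tens a (b + b') = tens a b + tens a b'.
Proof.
by rewrite -[b]scale1r -(rmorph1 iota) tens_linearr rmorph1 !scale1r.
Qed.

Lemma tens_combl (I : finType) (c : I -> R) (a : I -> A) b :
  tens (\sum_i iota (c i) *: a i) b = \sum_i c i *: tens (a i) b.
Proof.
rewrite (big_morph (fun a => tens a b) (fun a a' => tensDl a a' b) (tens0l b)).
by apply: eq_bigr => i _; rewrite tensZl.
Qed.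

Lemma tens_combr (I : finType) (c : I -> R) a (b : I -> B) :
  tens a (\sum_i iota (c i) *: b i) = \sum_i c i *: tens a (b i).
Proof.
rewrite (big_morph (tens a) (tensDr a) (tens0r a)).
by apply: eq_bigr => i _; rewrite tensZr.
Qed.

Lemma tensMnl a b n : tens (a *+ n) b = tens a b *+ n.
Proof.
by elim: n => [|n IHn]; rewrite ?mulr0n ?tens0l // !mulrS tensDl IHn.
Qed.

Lemma tensMnr a b n : tens a (b *+ n) = tens a b *+ n.
Proof.
by elim: n => [|n IHn]; rewrite ?mulr0n ?tens0r // !mulrS tensDr IHn.
Qed.

End Tensor.

(** * Expansion of both sides over pairs of edge maps *)

Section Main.
Variables (R : realType) (F : scalars) (G : graph) (Ep : {set edge G}).
Variables (x : edge G -> R) (k : nat).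
Hypotheses (orE : is_orientation Ep) (cG : connected [set: edge G]).
Hypotheses (x_gt0 : forall e, 0 < x e) (x_einv : forall e, x (einv e) = x e).
Local Notation K := (fieldK R F).
Local Notation iota := (ofR R F).
Local Notation Omega1 := (Omega1 G R F).
Local Notation estar := (estar R F).
Local Notation tens := (@tens R K iota (ext Omega1 k) (ext Omega1 k)).
Implicit Types (f g h : {ffun 'I_k -> edge G}) (S : {set edge G}).

(** Indexing by arbitrary maps instead of increasing ones makes each set of [k] edges occur [k!]
    times. *)
Definition estarW g : ext Omega1 k := wedge [ffun i => estar (g i)].

Lemma wedge_expand (A : 'I_k -> edge G -> R) :
  wedge [ffun i => \sum_e iota (A i e) *: estar e] *+ k`! =
  \sum_(g : {ffun 'I_k -> edge G})
    iota (\det (\matrix_(i, j) A i (g j))) *: estarW g.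
Proof.
rewrite (alternating_expand (fun i e => iota (A i e))).
- apply: eq_bigr => g _; rewrite -det_map_mx; congr (\det _ *: _).
  by apply/matrixP=> i j; rewrite !mxE.
- exact: wedge_multilinear.
- exact: wedge_alternating.
Qed.

Lemma sum_oriented (c : edge G -> R) :
  \sum_(e in Ep) iota (c e) *: estar e =
  \sum_e iota (if e \in Ep then c e else 0) *: estar e.
Proof.
rewrite big_mkcond; apply: eq_bigr => e _; case: ifP => // _.
by rewrite rmorph0 scale0r.
Qed.

Lemma det_oriented (B : 'I_k -> edge G -> R) g :
  \det (\matrix_(i, j) if g j \in Ep then B i (g j) else 0) =
  if [forall j, g j \in Ep] then \det (\matrix_(i, j) B i (g j)) else 0.
Proof.
case: ifPn => [/forallP gE|].
  by congr (\det _); apply/matrixP=> i j; rewrite !mxE gE.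
rewrite negb_forall => /existsP[j /negPf gj].
rewrite (expand_det_col _ j) big1 // => i _.
by rewrite !mxE gj mul0r.
Qed.

Definition J1Z : C1 G -> Omega1 :=
  plift intr (fun e => (iota (x e))^-1 *: estar e).

Lemma J1_rel0 (r : {freeg (edge G) / int}) : C1_rel r ->
  freelift intr (fun e => (iota (x e))^-1 *: estar e) r = 0.
Proof. by apply: C1_rel0 => e; rewrite x_einv estarN scalerN. Qed.

Lemma J1ZD c d : J1Z (c + d) = J1Z c + J1Z d.
Proof. exact: (pliftD J1_rel0). Qed.

Lemma J1Z0 : J1Z 0 = 0.
Proof. by apply: (addrI (J1Z 0)); rewrite -J1ZD !addr0. Qed.

Lemma J1Z_ech (n : int) e : J1Z (n *: ech e) = iota (n%:~R / x e) *: estar e.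
Proof.
rewrite -[n *: _]addr0 /J1Z (plift_semilin J1_rel0) (plift_gen J1_rel0).
by rewrite -/(J1Z 0) J1Z0 addr0 scalerA rmorphM /= rmorph_int fmorphV.
Qed.

Lemma extscal_rel0 (r : {freeg (C1 G) / K}) : extscal_rel r ->
  freelift (conjK R F) J1Z r = 0.
Proof.
by case=> b [d ->]; rewrite !freeliftB !freeliftU J1ZD addrAC addrK subrr.
Qed.

Lemma J1_tens1 (c : C1 G) : J1 F x (tens1 K c) =
  \sum_(e in Ep) iota ((ecoef e c)%:~R / x e) *: estar e.
Proof.
rewrite /J1 (plift_gen extscal_rel0) {1}(chainE orE c).
by rewrite (big_morph J1Z J1ZD J1Z0); apply: eq_bigr => e _; rewrite J1Z_ech.
Qed.

Lemma J1_semilinear (t : K) (p q : Omega_1 G R F) :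
  J1 F x (t *: p + q) = conjK R F t *: J1 F x p + J1 F x q.
Proof. exact: (plift_semilin extscal_rel0). Qed.

Definition cycleW (z : 'I_k -> C1 G) : ext Omega1 k :=
  extmap (conjK R F) (J1 F x) (det_cycles R F z).

Definition cycle_coef (z : 'I_k -> C1 G) g : R :=
  if [forall j, g j \in Ep] then (dZ z g)%:~R / \prod_j x (g j) else 0.

(** Integral chains have real coordinates, so the antilinearity of [J1] is invisible here; [J1]
    divides the coordinate along [e] by [x e], and these factors leave the minors column by
    column. *)
Lemma cycleW_expand z :
  cycleW z *+ k`! =
  \sum_(g : {ffun 'I_k -> edge G}) iota (cycle_coef z g) *: estarW g.
Proof.
rewrite /cycleW /det_cycles (extmap_wedge_comp _ _ J1_semilinear).
pose B i e : R := (ecoef e (z i))%:~R / x e.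
have -> : [ffun i => J1 F x (tens1 K (z i))] =
    [ffun i => \sum_e iota (if e \in Ep then B i e else 0) *: estar e].
  by apply/ffunP=> i; rewrite !ffunE J1_tens1 sum_oriented.
rewrite wedge_expand; apply: eq_bigr => g _; congr (iota _ *: _).
rewrite (det_oriented B) /cycle_coef; case: ifP => // _.
rewrite (det_scale_cols (fun i j => (ecoef (g j) (z i))%:~R)) prodfV.
congr (_ * _); rewrite /dZ -det_tr -det_map_mx; congr (\det _).
by apply/matrixP=> i j; rewrite !mxE.
Qed.

Lemma cycle_tens z : tens (cycleW z) (cycleW z) *+ (k`! * k`!) =
  \sum_(g : {ffun 'I_k -> edge G}) \sum_(f : {ffun 'I_k -> edge G})
    (cycle_coef z g * cycle_coef z f) *: tens (estarW g) (estarW f).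
Proof.
rewrite mulrnA -tensMnl -tensMnr !cycleW_expand tens_combl.
apply: eq_bigr => g _; rewrite tens_combr scaler_sumr.
by apply: eq_bigr => f _; rewrite scalerA.
Qed.

Local Notation Pi := (Pi_ker_dstar F Ep x).
Variable v0 : vertex G.
Local Notation P := (Pmat v0 Ep x).

Lemma Pi_linear (t : K) (a b : Omega1) :
  Pi (t *: a + b) = idfun t *: Pi a + Pi b.
Proof.
rewrite !(Pi_ker_dstarE orE x_gt0 v0 cG) scaler_sumr -big_split.
apply: eq_bigr => e' _; rewrite /= scalerA -scalerDl; congr (_ *: _).
rewrite mulr_sumr -big_split; apply: eq_bigr => e _ /=.
by rewrite hom_linE mulrDr mulrCA.
Qed.

Lemma Pi_estar e : e \in Ep ->
  Pi (estar e) = \sum_(e' in Ep) iota (P e' e) *: estar e'.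
Proof.
move=> eE; rewrite (Pi_ker_dstarE orE x_gt0 v0 cG); apply: eq_bigr => e' _.
congr (_ *: _); rewrite (bigD1 e) //= (estar_ech _ _ orE) // eqxx mulr1.
rewrite big1 ?addr0 // => f /andP[fE fe].
by rewrite (estar_ech _ _ orE) // (negPf fe) mulr0.
Qed.

Definition projW f : ext Omega1 k := wedge [ffun i => Pi (estar (f i))].

Lemma projW_expand f : (forall j, f j \in Ep) ->
  projW f *+ k`! =
  \sum_(g : {ffun 'I_k -> edge G}) iota (if [forall j, g j \in Ep] then
     \det (\matrix_(i, j) P (g i) (f j)) else 0) *: estarW g.
Proof.
move=> fE; pose B i e : R := P e (f i).
rewrite /projW (_ : [ffun i => _] =
    [ffun i => \sum_e iota (if e \in Ep then B i e else 0) *: estar e]).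
  rewrite wedge_expand; apply: eq_bigr => g _; congr (iota _ *: _).
  rewrite (det_oriented B); case: ifP => // _.
  by rewrite -det_tr; congr (\det _); apply/matrixP=> i j; rewrite !mxE.
by apply/ffunP=> i; rewrite !ffunE Pi_estar // sum_oriented.
Qed.

(** The summand of the right side for an ordered choice [f] of edges, with the two square roots
    merged. *)
Definition edgeW f : tensor iota (ext Omega1 k) (ext Omega1 k) :=
  (\prod_j x (f j))^-1 *: tens (projW f) (estarW f).

(** The sign of [s] comes out of both tensor factors and squares to 1. *)
Lemma edgeW_perm f (s : 'S_k) : edgeW [ffun i => f (s i)] = edgeW f.
Proof.
rewrite /edgeW; congr (_^-1 *: _).
  rewrite [RHS](reindex_inj (@perm_inj _ s)) /=.
  by apply: eq_bigr => i _; rewrite ffunE.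
have E1 : projW [ffun i => f (s i)] = iota ((-1) ^+ s) *: projW f.
  rewrite rmorph_sign; exact: (wedge_perm (fun e => Pi (estar e))).
have E2 : estarW [ffun i => f (s i)] = iota ((-1) ^+ s) *: estarW f.
  by rewrite rmorph_sign; exact: wedge_perm.
by rewrite E1 E2 tensZl tensZr scalerA -expr2 sqrr_sign scale1r.
Qed.

Lemma edgeW_noninj f : ~~ injectiveb f -> edgeW f = 0.
Proof.
case/injectivePn=> i [j ij fij].
rewrite /edgeW /estarW (wedge_alternating ij) ?tens0r ?scaler0 //.
by rewrite !ffunE fij.
Qed.

Variable le : rel (edge G).

Definition subsetW S : tensor iota (ext Omega1 k) (ext Omega1 k) :=
  let w := (iota (Num.sqrt (weight Ep x S)))^-1 *: estarS R F le k S in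
  tens (extmap idfun Pi w) w.

Lemma weight_oriented S : S \subset Ep -> weight Ep x S = \prod_(e in S) x e.
Proof.
move=> /subsetP SE; apply: eq_bigl => e; rewrite !inE.
apply/andP/idP => [[/orP[//|/imsetP[e' /SE eE ->]]]|eS].
  by rewrite (orientedN orE) eE.
by rewrite eS SE.
Qed.

Lemma subsetW_edgeW S f : S \subset Ep -> #|S| = k -> injective f ->
  S =i codom f -> subsetW S = edgeW f.
Proof.
move=> SE Sk fi Sf.
pose t := [tuple f i | i < k].
have perm_s : perm_eq (sort le (enum S)) t.
  apply: uniq_perm; first by rewrite sort_uniq enum_uniq.
    by rewrite map_inj_uniq ?enum_uniq.
  move=> e; rewrite mem_sort mem_enum Sf.
  by apply/codomP/mapP => [[i ->]|[i _ ->]]; exists i; rewrite ?mem_enum.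
(* The sorted list of [S] is a permutation of [f], and [edgeW] is invariant under permutations. *)
have [s es] := tuple_permP perm_s.
have -> : subsetW S = edgeW [ffun i => f (s i)]; last exact: edgeW_perm.
have -> : edgeW [ffun i => f (s i)] = (weight Ep x S)^-1 *:
    tens (projW [ffun i => f (s i)]) (estarW [ffun i => f (s i)]).
  rewrite /edgeW weight_oriented // (eq_bigl (fun e => e \in codom f)) //.
  have ucod : uniq (codom f) by apply/injectiveP.
  rewrite -(big_uniq _ ucod) big_image; congr (_^-1 *: _).
  rewrite [RHS](reindex_inj (@perm_inj _ s)) /=.
  by apply: eq_bigr => i _; rewrite ffunE.
rewrite /subsetW; have -> : estarS R F le k S = estarW [ffun i => f (s i)].
  congr wedge; apply/ffunP=> i; rewrite !ffunE es.
  by rewrite (nth_map (f i)) ?size_tuple // -tnth_nth !tnth_mktuple.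
(* Nonnegativity turns the square of the square root back into the weight. *)
have wS : 0 <= weight Ep x S by apply: prodr_ge0 => e _; exact: ltW.
rewrite (extmapZ _ _ Pi_linear) (extmap_wedge_comp _ _ Pi_linear) -fmorphV /=.
by rewrite tensZl tensZr scalerA -invfM -expr2 sqr_sqrtr.
Qed.

(** Maps that repeat an edge contribute zero; the others are grouped by image, with [k!] equal terms
    for each subset. *)
Lemma sum_subsetW :
  (\sum_(S : {set edge G} | (S \subset Ep) && (#|S| == k)) subsetW S) *+ k`! =
  \sum_(f : {ffun 'I_k -> edge G} | [forall j, f j \in Ep]) edgeW f.
Proof.
rewrite [RHS](bigID (fun f : {ffun 'I_k -> edge G} => injectiveb f)) /=.
rewrite [X in _ = _ + X]big1 ?addr0 => [|f /andP[_ /edgeW_noninj//]].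
rewrite (partition_big (fun f : {ffun 'I_k -> edge G} => [set e in codom f])
   (fun S => (S \subset Ep) && (#|S| == k))) /=; last first.
  move=> f /andP[/forallP fE /injectiveP fi].
  rewrite cardsE card_codom // card_ord eqxx andbT.
  by apply/subsetP=> e; rewrite inE => /codomP[j ->].
rewrite -sumrMnl; apply: eq_bigr => S /andP[SE /eqP Sk].
rewrite [RHS](eq_bigl (fun f : {ffun 'I_k -> edge G} =>
    injectiveb f && [forall j, f j \in S])).
  apply/esym/sumr_inj_ffuns => // f fi Sf.
  by rewrite (subsetW_edgeW SE Sk fi Sf).
move=> f; apply/andP/andP => [[/andP[_ fi] /eqP <-]|[fi /forallP fS]].
  by split=> //; apply/forallP=> j; rewrite inE codom_f.
have Sf := codom_inj_card Sk (elimT (injectiveP _) fi) fS.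
split; first by rewrite fi andbT; apply/forallP=> j; apply: (subsetP SE).
by apply/eqP/setP=> e; rewrite inE Sf.
Qed.

Lemma edgeW_expand f : (forall j, f j \in Ep) -> edgeW f *+ k`! =
  \sum_(g : {ffun 'I_k -> edge G})
    ((\prod_j x (f j))^-1 * (if [forall j, g j \in Ep] then
       \det (\matrix_(i, j) P (g i) (f j)) else 0)) *:
    tens (estarW g) (estarW f).
Proof.
move=> fE; rewrite /edgeW scalerMnr -tensMnl projW_expand // tens_combl.
by rewrite scaler_sumr; apply: eq_bigr => g _; rewrite scalerA.
Qed.

End Main.

Theorem proposition7p1 (R : realType) (F : scalars) (G : graph)
    (Ep : {set edge G}) (le : rel (edge G)) (x : edge G -> R) (k : nat)
    (Z : {set edge G} -> 'I_k -> C1 G) :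
  connected [set: edge G] ->
  is_orientation Ep ->
  is_total_order_on Ep le ->
  (forall e, 0 < x e) ->
  (forall e, x (einv e) = x e) ->
  (forall S, S \in conn_subgraphs G k -> is_Zbasis (Z1 S) (Z S)) ->
  \sum_(S in conn_subgraphs G k)
     weight Ep x S *:
       (let u := extmap (conjK R F) (J1 F x) (det_cycles R F (Z S)) in
        tens (ofR R F) u u)
  = (\sum_(T in spanning_trees G) weight Ep x T) *:
    \sum_(S : {set edge G} | (S \subset Ep) && (#|S| == k))
       (let w := (ofR R F (Num.sqrt (weight Ep x S)))^-1 *: estarS R F le k S in
        tens (ofR R F) (extmap idfun (Pi_ker_dstar F Ep x) w) w).
Proof.
move=> cG orE _ x_gt0 x_einv ZB.
have /andP[/card_gt0P[v0 _] _] := cG.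
change (\sum_(S in conn_subgraphs G k) weight Ep x S *:
    tens (ofR R F) (cycleW F x (Z S)) (cycleW F x (Z S)) =
  (\sum_(T in spanning_trees G) weight Ep x T) *:
    \sum_(S : {set edge G} | (S \subset Ep) && (#|S| == k))
      subsetW F Ep x k le S).
(* On the left, each tensor factor absorbs one [k!]. On the right, one is absorbed by the sum over
   subsets and the other by the expansion of the projected wedge. *)
have N0 : (k`! * k`!)%:R != 0 :> R.
  by rewrite pnatr_eq0 muln_eq0 negb_or -!lt0n fact_gt0.
apply: (scalerI N0); rewrite !scaler_nat.
(* Both sides become combinations of the tensors of [estarW g] and [estarW f], and it suffices to
   compare coefficients. *)
transitivity (\sum_(g : {ffun 'I_k -> edge G}) \sum_(f : {ffun 'I_k -> edge G})
    (\sum_(S in conn_subgraphs G k)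
       weight Ep x S * (cycle_coef Ep x (Z S) g * cycle_coef Ep x (Z S) f)) *:
    tens (ofR R F) (estarW R F g) (estarW R F f)).
  rewrite -sumrMnl.
  under eq_bigr => S _ do
    rewrite scalerMnr (cycle_tens F orE x_einv) scaler_sumr.
  rewrite exchange_big; apply: eq_bigr => g _ /=.
  under eq_bigr => S _ do rewrite scaler_sumr.
  rewrite exchange_big; apply: eq_bigr => f _ /=.
  by rewrite scaler_suml; apply: eq_bigr => S _; rewrite scalerA.
rewrite mulrnA !scalerMnr (sum_subsetW F k orE cG x_gt0 v0).
rewrite -sumrMnl [X in _ = _ *: X]big_mkcond [LHS]exchange_big scaler_sumr.
apply: eq_bigr => f _ /=.
have [/forallP fE|fE] := boolP [forall j, f j \in Ep]; last first.
  rewrite scaler0 big1 // => g _; rewrite big1 ?scale0r // => S _.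
  by rewrite /cycle_coef (negPf fE) !mulr0.
rewrite (edgeW_expand F orE cG x_gt0 v0) // scaler_sumr; apply: eq_bigr => g _.
rewrite scalerA; congr (_ *: _); rewrite /cycle_coef.
have [/forallP gE|gE] := boolP [forall j, g j \in Ep]; last first.
  by rewrite !mulr0 big1 // => S _; rewrite mul0r mulr0.
have /forallP -> := fE.
have prod_neq0 (h : {ffun 'I_k -> edge G}) : \prod_j x (h j) != 0.
  by rewrite gt_eqF // prodr_gt0.
(* The left coefficients carry the inverse weights of both [g] and [f]. By [conn_tree_sum] the
   weights of [g] reappear and cancel, leaving the inverse weights of [f] as in [edgeW]. *)
transitivity ((\prod_j x (g j))^-1 * (\prod_j x (f j))^-1 *
  \sum_(S in conn_subgraphs G k) weight Ep x S * (dZ (Z S) g * dZ (Z S) f)%:~R).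
  rewrite mulr_sumr; apply: eq_bigr => S _; rewrite rmorphM /=.
  by ring.
rewrite (conn_tree_sum v0 orE cG x_gt0 ZB gE fE).
have := prod_neq0 g; have := prod_neq0 f; move=> f0 g0; field.
by rewrite f0 g0.
Qed.
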